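(* For all integers $n \geq 0$: \begin{enumerate} \item $a_7(2n+2) \geq 2a_7(n)$; \item $a_7(4n+6) \geq 10a_7(n)$; \item $a_{7,0}(n) \geq 9a_{7,2}(n)$; \item $a_{7,1}(n) \geq 2a_{7,-1}(n)$; \item $a_7(28n+4r) = 5a_7(14n+2r-1)$ for $r = 1, 2, 6$; \item $a_7(28n+4r+2) + 4a_7(7n+r-1) = 5a_7(14n+2r)$ for $r = 2, 4, 5$. \end{enumerate}
   Context: A partition $\pi=(\lambda_1,\dots,\lambda_r)$ of $n$ is a nonincreasing sequence of positive integers summing to $n$. A partition is a $t$-core if it has no hook (rim hook) of length $t$. $a_7(n)$ denotes the number of 7-core partitions of $n$ (so $\sum_{n\ge0}a_7(n)q^n=\prod_{j\ge1}(1-q^{7j})^7/(1-q^j)$). The BG-rank of $\pi=(\lambda_1,\dots,\lambda_r)$ is $\sum_{j=1}^r(-1)^{j+1}\mathrm{par}(\lambda_j)$, where $\mathrm{par}(\lambda)=1$ if $\lambda$ is odd and $0$ if $\lambda$ is even. $a_{7,j}(n)$ denotes the number of 7-core partitions of $n$ with BG-rank equal to $j$. *)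

(* Defs.v *)
From HB Require Import structures.
From mathcomp Require Import all_boot all_order all_algebra.

Set Implicit Arguments.
Unset Strict Implicit.
Unset Printing Implicit Defensive.

Definition is_partition (n : nat) (s : seq nat) : bool :=
  [&& sorted geq s, all (fun x => 0 < x) s & sumn s == n].

(* The Young diagram of s has the cells (i, j), numbered from 0, with
   i < size s and j < nth 0 s i. *)
Definition conj_part (s : seq nat) (j : nat) : nat :=
  count (fun x => j < x) s.

Definition arm (s : seq nat) (i j : nat) : nat := nth 0 s i - j.+1.

Definition leg (s : seq nat) (i j : nat) : nat := conj_part s j - i.+1.

Definition hook_length (s : seq nat) (i j : nat) : nat :=
  arm s i j + leg s i j + 1.

Definition is_core (t : nat) (s : seq nat) : bool :=
  [forall i : 'I_(size s), forall j : 'I_(nth 0 s i), hook_length s i j != t].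

(* Parts are numbered from 0 here, so that the sign of the j-th part of the
   usual numbering, (-1)^(j+1), becomes (-1)^i with i = j - 1. *)
Definition BG_rank (s : seq nat) : int :=
  (\sum_(i < size s) (-1) ^+ i * (odd (nth 0%N s i))%:Z)%R.

(* A partition of n has at most n parts, each at most n, so the sequences of
   length at most n over {0, ..., n} contain all of them; see nb_partitionsE. *)
Definition nb_partitions (n : nat) (P : pred (seq nat)) : nat :=
  #|[set s : n.-bseq 'I_n.+1 |
      is_partition n (map val s) && P (map val s)]|.

Definition a7 (n : nat) : nat := nb_partitions n (is_core 7).

Definition a7_BG (j : int) (n : nat) : nat :=
  nb_partitions n (fun s => is_core 7 s && (BG_rank s == j)).

Lemma partition_bseq n s : is_partition n s ->
  exists b : n.-bseq 'I_n.+1, map val b = s.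
Proof.
case/and3P=> _ pos_s /eqP sum_s.
have size_s : size s <= n.
  rewrite -sum_s; elim: s pos_s {sum_s} => //= x s IHs /andP[x_gt0 /IHs].
  by move=> le_s; rewrite -add1n leq_add.
have lt_s x : x \in s -> x < n.+1.
  rewrite ltnS -sum_s; elim: s {pos_s sum_s size_s} => //= y s IHs.
  rewrite inE => /orP[/eqP-> | /IHs le_x]; first exact: leq_addr.
  exact: leq_trans le_x (leq_addl _ _).
have size_b : size (map (@inord n) s) <= n by rewrite size_map.
exists (Bseq size_b); rewrite /= -map_comp -[RHS]map_id.
by apply/eq_in_map => x /lt_s lt_x /=; rewrite inordK.
Qed.

Lemma nb_partitionsE n (P : pred (seq nat)) (l : seq (seq nat)) :
    uniq l -> (forall s, (s \in l) = is_partition n s && P s) ->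
  nb_partitions n P = size l.
Proof.
move=> uniq_l mem_l; rewrite /nb_partitions cardE.
set A := [set _ | _].
pose f (b : n.-bseq 'I_n.+1) : seq nat := map val b.
have f_inj : injective f by move=> b c /(inj_map val_inj)/val_inj.
rewrite -(size_map f); apply/perm_size/uniq_perm => //.
  by rewrite map_inj_uniq ?enum_uniq.
move=> s; rewrite mem_l; apply/mapP/idP => [[b] | s_ok].
  by rewrite mem_enum inE => b_ok ->.
have /andP[/partition_bseq[b def_s] _] := s_ok.
by exists b; rewrite ?mem_enum ?inE ?def_s // /f def_s.
Qed.

(* Main.v *)
From Stdlib Require Import ZArith Lia.
Require Import Defs.
From HB Require Import structures.
From mathcomp Require Import all_boot all_order all_algebra.
From mathcomp Require Import zify ssrZ.

Set Implicit Arguments.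
Unset Strict Implicit.
Unset Printing Implicit Defensive.

Import GRing.Theory.

(** Reading off the runners of the 7-abacus identifies the 7-cores of n with the
    x in Z^7 such that x_i = i - 3 (mod 7), sum x_i = 0 and |x|^2 = 14 (n + 2);
    the BG-rank is then (4 - k) / 2, where k is the number of odd x_i.

    Up to affine changes of the index in Z/7, these x are the vectors outside a
    hyperplane modulo sqrt(-7) in a lattice M of rank 3 over the ring O of
    integers of Q(sqrt(-7)).  Let A(m) be the number of such vectors of norm m
    in M, and B(m) the same number for O^3.  Among the seven natural neighbours
    at 2, M has only copies of O^3, and O^3 has six copies of itself and one of
    M, whence
      A(2m) + 2 A(m) + 4 A(m/2) = 7 B(m),
      B(2m) + 2 B(m) + 4 B(m/2) = 6 B(m) + A(m).
    So A + 7B and B - A satisfy f(2m) = t f(m) - 4 f(m/2) for t = 5 and t = -3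
    (they are the Eisenstein and the CM part), and the growth of A follows from
    A >= 0 and 7 B >= 4 A.

    There are eight isotropic hyperplanes modulo sqrt(-7), permuted transitively
    by the symmetries of O^3, which preserve M, and the sections of M and of O^3
    by such a hyperplane are isometric.  If m is not a square modulo 7, every
    vector of norm m lies on exactly two of them, so that A(m) = B(m).

    The 28 classes modulo 2 of odd norm correspond to the pairs of hyperplanes.
    A vector off a given hyperplane lies on at most two of the others, which
    bounds the vectors with six odd entries by those with two odd entries. *)
(* Without this instance, lia does not understand [==] on Z. *)
Fact eq_op_Z (a b : Z) : (a == b) = Z.eqb a b.
Proof. by []. Qed.

#[global] Instance Op_eq_op_Z : ZifyClasses.BinOp (@eq_op _ : Z -> Z -> bool) :=
  { TBOp := Z.eqb; TBOpInj := eq_op_Z }.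
Add Zify BinOp Op_eq_op_Z.

Ltac Zify.zify_post_hook ::=
  ZifyBool.elim_bool_cstr;
  zify_ssreflect.SsreflectZifyInstances.divZ_modZ_to_equations;
  Z.div_mod_to_equations.

(** * Comparison of counts along a relation *)

Section Counting.

Variables T1 T2 : eqType.
Variables (l1 : seq T1) (l2 : seq T2) (P1 : pred T1) (P2 : pred T2).
Variable r : T1 -> T2 -> Prop.

(** A partner is chosen for each [x] in turn, and injectivity keeps the partners distinct. With a
    relation in place of a map, witnesses are needed only on [P1], so no inverse has to be defined
    outside the lattices below. *)
Lemma leq_count_rel :
    uniq l1 -> (forall y, P2 y -> y \in l2) ->
    (forall x, P1 x -> exists2 y, P2 y & r x y) ->
    (forall x x' y, r x y -> r x' y -> x = x') ->
  count P1 l1 <= count P2 l2.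
Proof.
move=> uniq_l1 P2_l2 total_r inj_r; rewrite -!size_filter.
have [t [<- uniq_t t_r]] : exists t : seq T2,
    [/\ size t = size (filter P1 l1), uniq t
      & forall y, y \in t -> P2 y /\ exists2 x, x \in filter P1 l1 & r x y].
  have: all P1 (filter P1 l1) by exact: filter_all.
  elim: (filter P1 l1) (filter_uniq P1 uniq_l1) => [_ _|x s IHs].
    by exists [::].
  move=> /= /andP[x_s uniq_s] /andP[P1x] /(IHs uniq_s)[t [sz_t uniq_t t_r]].
  have [y P2y r_xy] := total_r x P1x; exists (y :: t); split=> /=.
  - by rewrite sz_t.
  - rewrite uniq_t andbT; apply/negP => /t_r[_ [x' x'_s r_x'y]].
    by move: x_s; rewrite (inj_r _ _ _ r_xy r_x'y) x'_s.
  move=> z; rewrite inE => /orP[/eqP->|/t_r[P2z [x' x'_s r_x'z]]].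
    by split=> //; exists x; rewrite ?mem_head.
  by split=> //; exists x'; rewrite // inE x'_s orbT.
apply: uniq_leq_size => // y /t_r[P2y _].
by rewrite mem_filter P2y P2_l2.
Qed.

End Counting.

Lemma eq_count_rel (T1 T2 : eqType) (l1 : seq T1) (l2 : seq T2)
    (P1 : pred T1) (P2 : pred T2) (r : T1 -> T2 -> Prop) :
    uniq l1 -> uniq l2 ->
    (forall x, P1 x -> x \in l1) -> (forall y, P2 y -> y \in l2) ->
    (forall x, P1 x -> exists2 y, P2 y & r x y) ->
    (forall y, P2 y -> exists2 x, P1 x & r x y) ->
    (forall x y y', r x y -> r x y' -> y = y') ->
    (forall x x' y, r x y -> r x' y -> x = x') ->
  count P1 l1 = count P2 l2.
Proof.
move=> u1 u2 m1 m2 tot1 tot2 fun_r inj_r; apply/eqP; rewrite eqn_leq.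
rewrite (leq_count_rel u1 m2 tot1 inj_r) /=.
apply: (leq_count_rel (r := fun y x => r x y) u2 m1 tot2) => y y' x.
exact: fun_r.
Qed.

(** * Beta-sets of t-cores *)

Lemma mem_downset (l : seq nat) : uniq l -> (forall q, q.+1 \in l -> q \in l) ->
  forall q, (q \in l) = (q < size l).
Proof.
move=> uniq_l down_l.
have down q k : q + k \in l -> q \in l.
  by elim: k => [|k IHk]; rewrite ?addn0 // addnS => /down_l.
move=> q; apply/idP/idP => [q_l | ].
  rewrite -(size_iota 0 q.+1); apply: uniq_leq_size; rewrite ?iota_uniq // => p.
  by rewrite mem_iota /= ltnS => /subnKC pq; apply: (down p (q - p)); rewrite pq.
apply: contraTT => q_l; rewrite -leqNgt -(size_iota 0 q).
apply: uniq_leq_size => // p p_l; rewrite mem_iota /= add0n ltnNge.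
by apply: contra q_l => /subnKC qp; apply: (down q (p - q)); rewrite qp.
Qed.

Section BetaSets.

Variable t : nat.
Hypothesis t_gt0 : 0 < t.

(** On the abacus with [t] runners: no bead can slide one place back along its runner. *)
Definition runner_closed (l : seq nat) : bool := all (fun b => (b < t) || (b - t \in l)) l.

Definition runner_count (l : seq nat) (i : nat) : nat := count (fun b => b %% t == i) l.

Definition beads (c : nat -> nat) : seq nat :=
  [seq i + t * j | i <- iota 0 t, j <- iota 0 (c i)].

(** The rows occupied on one runner are closed downwards, hence form an initial segment. *)
Lemma mem_runner l : uniq l -> runner_closed l ->
  forall b, (b \in l) = (b %/ t < runner_count l (b %% t)).
Proof.
move=> uniq_l closed_l b; set r := b %% t.
pose qs := [seq b' %/ t | b' <- filter (fun b' => b' %% t == r) l].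
have mem_qs q : (q \in qs) = (q * t + r \in l).
  apply/mapP/idP => [[b'] | ql]; last first.
    exists (q * t + r); last by rewrite divnMDl // divn_small ?addn0 ?ltn_mod.
    by rewrite mem_filter modnMDl modn_mod eqxx.
  by rewrite mem_filter => /andP[/eqP b'r b'l] ->; rewrite -b'r -divn_eq.
have uniq_qs : uniq qs.
  rewrite map_inj_in_uniq ?filter_uniq // => b1 b2.
  rewrite !mem_filter => /andP[/eqP h1 _] /andP[/eqP h2 _] h.
  by rewrite (divn_eq b1 t) (divn_eq b2 t) h h1 h2.
rewrite /runner_count -size_filter -(size_map (fun b' => b' %/ t)) -/qs.
rewrite -mem_downset // ?mem_qs -?divn_eq // => q; rewrite !mem_qs.
move/(allP closed_l); rewrite mulSn -addnA addKn => /orP[|//].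
by rewrite ltnNge leq_addr.
Qed.

Lemma mem_beads c b : (b \in beads c) = (b %/ t < c (b %% t)).
Proof.
apply/allpairsPdep/idP => [[i [j [i_t j_c ->]]] | b_c].
  move: i_t j_c; rewrite !mem_iota /= !add0n => i_t j_c.
  by rewrite mulnC addnC divnMDl // divn_small // addn0 modnMDl modn_small.
exists (b %% t), (b %/ t); rewrite !mem_iota /= !add0n ltn_mod t_gt0 b_c.
by rewrite mulnC addnC -divn_eq.
Qed.

Lemma beads_uniq c : uniq (beads c).
Proof.
apply: allpairs_uniq_dep; rewrite ?iota_uniq //; first by move=> i _; exact: iota_uniq.
move=> _ _ /allpairsPdep[i [j [i_t _ ->]]] /allpairsPdep[i' [j' [i'_t _ ->]]] /=.
move: i_t i'_t; rewrite !mem_iota /= !add0n => i_t i'_t eq_ij.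
have eq_i : i = i'.
  by have := congr1 (modn^~ t) eq_ij; rewrite !(addnC _ (t * _)) !(mulnC t) !modnMDl !modn_small.
move: eq_ij; rewrite eq_i => /addnI/eqP; rewrite eqn_pmul2l // => /eqP->.
by [].
Qed.

Lemma runner_countE l : uniq l -> runner_closed l ->
  perm_eq l (beads (runner_count l)).
Proof.
move=> uniq_l closed_l; apply: uniq_perm => // [|b]; first exact: beads_uniq.
by rewrite mem_beads -mem_runner.
Qed.

Lemma beads_closed c l : l =i beads c -> runner_closed l.
Proof.
move=> l_c; apply/allP => b; rewrite !l_c !mem_beads.
have [//|t_b] := ltnP b t => b_c; apply/orP; right.
move: b_c; rewrite -{1 2}(subnK t_b) divnDr ?dvdnn // divnn t_gt0 addn1 modnDr.
exact: ltnW.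
Qed.

Lemma runner_count_beads c l i : i < t -> perm_eq l (beads c) -> runner_count l i = c i.
Proof.
move=> i_t /permP eq_l; rewrite /runner_count eq_l -/(runner_count (beads c) i).
have uniq_l := beads_uniq c.
have closed_c : runner_closed (beads c) by apply: (@beads_closed c).
have eq_lt j : (j < runner_count (beads c) i) = (j < c i).
  have := mem_runner uniq_l closed_c (j * t + i).
  by rewrite mem_beads divnMDl // modnMDl divn_small // modn_small // addn0.
apply/eqP; rewrite eqn_leq.
by rewrite leqNgt eq_lt ltnn /= leqNgt -eq_lt ltnn.
Qed.

End BetaSets.

Section Beta.

Variable N : nat.

(** The beta-set of [s] with [N] beads, in decreasing order; the default 0 of [nth] pads [s] with
    zero parts. *)
Definition beta (s : seq nat) : seq nat := mkseq (fun i => nth 0 s i + (N - i.+1)) N.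

Lemma size_beta s : size (beta s) = N.
Proof. exact: size_mkseq. Qed.

Lemma nth_beta s i : i < N -> nth 0 (beta s) i = nth 0 s i + (N - i.+1).
Proof. exact: nth_mkseq. Qed.

Lemma geq_nth s i j : sorted geq s -> i <= j -> nth 0 s j <= nth 0 s i.
Proof.
move=> sorted_s le_ij; have [j_s|/(nth_default 0)->//] := ltnP j (size s).
have geq_trans : transitive geq by move=> a b c /= ab bc; apply: leq_trans bc ab.
have i_s := leq_ltn_trans le_ij j_s.
by have /(_ i j i_s j_s le_ij) := sorted_leq_nth geq_trans leqnn 0 sorted_s.
Qed.

Lemma sorted_beta s : sorted geq s -> sorted gtn (beta s).
Proof.
move=> sorted_s; apply/(sortedP 0) => i; rewrite size_beta => i_N.
rewrite !nth_beta //; last exact: ltnW.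
by have := geq_nth sorted_s (leqnSn i); rewrite /=; lia.
Qed.

Lemma uniq_beta s : sorted geq s -> uniq (beta s).
Proof.
move/sorted_beta; apply: sorted_uniq => [a b c /= ab bc | a /=]; last exact: ltnn.
exact: ltn_trans bc ab.
Qed.

Lemma ltn_conj_part s j k : sorted geq s -> (k < conj_part s j) = (j < nth 0 s k).
Proof.
rewrite /conj_part => sorted_s.
have [k_s|] := ltnP k (size s); last first.
  move=> s_k; rewrite nth_default // ltn0 ltnNge (leq_trans (count_size _ _)) //.
elim: s k sorted_s k_s => // x s IHs k /= path_s; have sorted_s := path_sorted path_s.
have [j_x|x_j] := ltnP j x; first by case: k => [|k] k_s //=; rewrite add1n ltnS IHs.
have -> : count (fun y => j < y) s = 0.
  apply/eqP; rewrite -leqn0 leqNgt -has_count; apply/hasPn => y y_s.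
  rewrite -leqNgt (leq_trans _ x_j) //.
  have geq_trans : transitive geq by move=> a b c /= ab bc; apply: leq_trans bc ab.
  by have /allP/(_ y y_s) := order_path_min geq_trans path_s.
move=> _; rewrite ltn0; symmetry; apply/negbTE; rewrite -leqNgt.
by apply: leq_trans x_j; apply: (@geq_nth (x :: s) 0 k).
Qed.
End Beta.

(** Column [j] corresponds to the gap [N - conj_part s j + j] of the beta-set, and the hook length
    at [(i, j)] is the [i]-th entry minus this gap. So a hook of length [t] is an entry [b] for
    which [b - t] is a gap. *)
Lemma is_core_beta t N s : 0 < t -> sorted geq s -> size s <= N ->
  is_core t s = runner_closed t (beta N s).
Proof.
move=> t_gt0 sorted_s s_N; apply/idP/idP => [core_s | closed_s].
  apply/allP => b /(nthP 0)[i]; rewrite size_beta => i_N <-.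
  have [//|t_b] := ltnP; apply/negPn/negP => gap.
  set y := _ - t in gap.
  have gap_nth k : k < N -> nth 0 (beta N s) k != y.
    by move=> k_N; apply: contra gap => /eqP <-; rewrite mem_nth ?size_beta.
  (* Exactly the first [k] entries exceed the gap [y]; its column is [y + k - N], which will turn
     out to have [k] cells. *)
  pose k := find (fun b => b <= y) (beta N s).
  have k_N : k <= N by rewrite -(size_beta N s) find_size.
  have lt_y l : l < k -> y < nth 0 (beta N s) l.
    by move=> l_k; rewrite ltnNge; apply/negbT/(before_find 0 l_k).
  have gt_y : k < N -> nth 0 (beta N s) k < y.
    move=> lt_kN; rewrite ltn_neqAle gap_nth //=; apply: (@nth_find _ 0 (fun b => b <= y)).
    by rewrite has_find size_beta.
  have i_k : i < k.
    rewrite ltnNge; apply/negP => k_i.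
    have lt_kN := leq_ltn_trans k_i i_N.
    have := gt_y lt_kN; have := geq_nth sorted_s k_i.
    by move: t_b; rewrite /y !nth_beta //; lia.
  have N_yk : N <= y + k.
    move: k_N; rewrite leq_eqVlt => /orP[/eqP->|lt_kN]; first exact: leq_addl.
    by move: (gt_y lt_kN); rewrite nth_beta //; lia.
  have s_i : nth 0 s i = y + t + i.+1 - N.
    by rewrite /y subnK // nth_beta //; lia.
  clearbody k y.
  have j_lt l : (y + k - N < nth 0 s l) = (l < k).
    have [l_k|k_l] := ltnP l k.
      have k1_k : k.-1 < k by lia.
      have l_k1 : l <= k.-1 by lia.
      by move: (lt_y _ k1_k) (geq_nth sorted_s l_k1); rewrite nth_beta; lia.
    apply/negbTE; rewrite -leqNgt; have [l_N|N_l] := ltnP l N; last first.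
      by rewrite nth_default ?(leq_trans s_N).
    have lt_kN := leq_ltn_trans k_l l_N.
    by move: (gt_y lt_kN) (geq_nth sorted_s k_l); rewrite nth_beta //; lia.
  have conj_k : conj_part s (y + k - N) = k.
    apply/eqP; rewrite eqn_leq leqNgt ltn_conj_part // j_lt ltnn /= leqNgt.
    apply/negP => lt_conj.
    by have := ltn_conj_part (y + k - N) (conj_part s (y + k - N)) sorted_s;
       rewrite ltnn j_lt lt_conj.
  have i_s : i < size s.
    by rewrite ltnNge; apply/negP => s_i'; have := j_lt i; rewrite nth_default // i_k.
  have j_i : y + k - N < nth 0 s i by rewrite j_lt.
  have /forallP/(_ (Ordinal i_s))/forallP/(_ (Ordinal j_i))/eqP[] := core_s.
  by rewrite /hook_length /arm /leg /= conj_k s_i; lia.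
apply/forallP => -[i i_s]; apply/forallP => -[j j_i] /=; apply/eqP => hook_t.
have {}j_i : j < nth 0 s i := j_i.
have i_N : i < N := leq_trans i_s s_N.
have i_c : i < conj_part s j by rewrite ltn_conj_part.
have c_s : conj_part s j <= size s by apply: count_size.
have beta_i : nth 0 (beta N s) i = t + (N - conj_part s j + j).
  by rewrite nth_beta //; move: hook_t; rewrite /hook_length /arm /leg; lia.
have : nth 0 (beta N s) i \in beta N s by rewrite mem_nth ?size_beta.
move/(allP closed_s); rewrite beta_i addKn ltnNge leq_addr /= => /(nthP 0)[k].
rewrite size_beta => k_N; rewrite nth_beta //.
(* The [k]-th entry lies above the gap of column [j] if row [k] meets that column, and below it
   otherwise. *)
have := ltn_conj_part j k sorted_s.
by case: (ltnP k (conj_part s j)) => h /esym h'; lia.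
Qed.

Definition unbeta (N : nat) (l : seq nat) : seq nat :=
  filter (fun x => 0 < x) (mkseq (fun i => nth 0 l i - (N - i.+1)) N).

(** The zeros of a nonincreasing sequence come last, so removing them only truncates it, and [nth]
    returns 0 beyond the end anyway. *)
Lemma nth_filter_gt0 l i : sorted geq l -> nth 0 (filter (fun x => 0 < x) l) i = nth 0 l i.
Proof.
elim: l i => // x l IHl i path_l; have sorted_l := path_sorted path_l.
case: i => [|i] /=; first by case: x path_l => // path_l; rewrite IHl //
  (eqP (_ : nth 0 l 0 == 0)) // -leqn0; apply: (@geq_nth (0 :: l) 0 1).
case: (posnP x) path_l => [-> | _] path_l /=; last exact: IHl.
rewrite IHl //; have := @geq_nth (0 :: l) 0 i.+2 path_l isT.
by have := @geq_nth (0 :: l) 0 i.+1 path_l isT; rewrite /= !leqn0 => /eqP-> /eqP->.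
Qed.

Lemma gtn_sorted_nth l i j : sorted gtn l -> i <= j < size l ->
  nth 0 l j + (j - i) <= nth 0 l i.
Proof.
move=> sorted_l /andP[/subnKC <-]; elim: (j - i) => [|d IHd].
  by rewrite addn0 subnn addn0.
rewrite addnS => d_l; have := IHd (ltnW d_l).
by have /(sortedP 0)/(_ (i + d) d_l) := sorted_l; rewrite /=; lia.
Qed.

Lemma sorted_gaps N l : size l = N -> sorted gtn l ->
  sorted geq (mkseq (fun i => nth 0 l i - (N - i.+1)) N).
Proof.
move=> size_l sorted_l; apply/(sortedP 0) => j; rewrite size_mkseq => j_N.
rewrite !nth_mkseq //; last exact: ltnW.
by have := @gtn_sorted_nth l j j.+1 sorted_l; rewrite size_l /=; lia.
Qed.

(** In a strictly decreasing list of [N] naturals the entry of index [i] is at least [N - i - 1], so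
    the truncated subtraction in [unbeta] is exact. *)
Lemma unbetaK N l : size l = N -> sorted gtn l -> beta N (unbeta N l) = l.
Proof.
move=> size_l sorted_l.
apply: (@eq_from_nth _ 0); rewrite size_beta ?size_l // => i i_N.
rewrite nth_beta // /unbeta nth_filter_gt0 ?nth_mkseq //; last exact: sorted_gaps.
by apply: subnK; have := @gtn_sorted_nth l i N.-1 sorted_l; rewrite size_l; lia.
Qed.

Lemma beta_inj N s1 s2 :
    sorted geq s1 -> sorted geq s2 -> all (fun x => 0 < x) s1 ->
    all (fun x => 0 < x) s2 -> size s1 <= N -> size s2 <= N ->
    beta N s1 = beta N s2 -> s1 = s2.
Proof.
move=> sorted1 sorted2 pos1 pos2 size1 size2 eq_beta.
have eq_nth i : nth 0 s1 i = nth 0 s2 i.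
  have [i_N|N_i] := ltnP i N; last by rewrite !nth_default // (leq_trans _ N_i).
  by have := congr1 (fun l => nth 0 l i) eq_beta; rewrite /= !nth_beta //; lia.
have size_pos s : all (fun x => 0 < x) s -> forall i, (i < size s) = (0 < nth 0 s i).
  move=> /all_nthP pos_s i; have [/(pos_s 0)->//|s_i] := ltnP i (size s).
  by rewrite nth_default.
apply: (@eq_from_nth _ 0) => [|i _]; last exact: eq_nth.
apply/eqP; rewrite eqn_leq leqNgt (size_pos s1) // eq_nth -(size_pos s2) // ltnn /=.
by rewrite leqNgt (size_pos s2) // -eq_nth -(size_pos s1) // ltnn.
Qed.

Lemma big_iota (R : Type) (idx : R) (op : R -> R -> R) (n : nat) (F : nat -> R) :
  \big[op/idx]_(i <- iota 0 n) F i = \big[op/idx]_(i < n) F i.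
Proof. by rewrite -(big_mkord xpredT) /index_iota subn0. Qed.

Lemma big_beads (R : Type) (idx : R) (op : Monoid.law idx) t c (F : nat -> R) :
  \big[op/idx]_(b <- beads t c) F b
    = \big[op/idx]_(i < t) \big[op/idx]_(j < c i) F (i + t * j).
Proof.
by rewrite big_allpairs_dep big_iota; apply: eq_bigr => i _; exact: big_iota.
Qed.

(** An arithmetic progression, doubled and with [t * c] moved to the left so that neither division
    nor subtraction occurs in [nat]. *)
Lemma sum_runner (i t c : nat) :
  2 * (\sum_(j < c) (i + t * j)) + t * c = 2 * (i * c) + t * (c * c).
Proof.
elim: c => [|c IHc]; first by rewrite big_ord0; lia.
rewrite big_ord_recr /=; move: (\sum_(j < c) _) IHc => S IHc. nia.
Qed.

Lemma sum_nth_sumn s N : size s <= N -> \sum_(i < N) nth 0 s i = sumn s.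
Proof.
move=> s_N; rewrite sumnE (big_nth 0) -(big_mkord xpredT (nth 0 s)).
rewrite (big_cat_nat (n := size s)) //=.
have -> : \sum_(size s <= i < N) nth 0 s i = 0.
  by rewrite big_nat big1 // => i /andP[s_i _]; rewrite nth_default.
by rewrite addn0.
Qed.

Lemma sum_beta N s : size s <= N ->
  2 * (\sum_(b <- beta N s) b) + N = 2 * sumn s + N * N.
Proof.
move=> s_N; rewrite big_map big_iota big_split /= sum_nth_sumn //.
rewrite mulnDr -addnA; congr addn.
rewrite (reindex_inj rev_ord_inj) /=.
have -> : \sum_(j < N) (N - (N - j.+1).+1) = \sum_(j < N) (0 + 1 * j).
  by apply: eq_bigr => j _; have := ltn_ord j; lia.
have := sum_runner 0 1 N; move: (\sum_(j < N) _) => S; lia.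
Qed.

(** * Counting integer vectors *)

Local Open Scope Z_scope.

Arguments Z.add : simpl never.
Arguments Z.opp : simpl never.
Arguments Z.sub : simpl never.
Arguments Z.mul : simpl never.
Arguments Z.modulo : simpl never.
Arguments Z.div : simpl never.
Arguments Z.odd : simpl never.
Arguments Z.even : simpl never.

Definition rng (B : Z) : seq Z :=
  [seq Z.of_nat i - B | i <- iota 0 (Z.to_nat (2 * B + 1))].

Lemma rng_uniq B : uniq (rng B).
Proof. by rewrite map_inj_uniq ?iota_uniq // => i j; lia. Qed.

Lemma mem_rng B z : - B <= z <= B -> z \in rng B.
Proof.
move=> zB; apply/mapP; exists (Z.to_nat (z + B)); last by lia.
by rewrite mem_iota; lia.
Qed.

Definition box (T : Type) (l : seq T) (B : Z) : seq (T * Z) :=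
  [seq (x, z) | x <- l, z <- rng B].

Lemma box_uniq (T : eqType) (l : seq T) B : uniq l -> uniq (box l B).
Proof.
by move=> uniq_l; apply: allpairs_uniq; rewrite ?rng_uniq // => -[? ?] [? ?].
Qed.

Lemma mem_box (T : eqType) (l : seq T) B x z :
  x \in l -> - B <= z <= B -> (x, z) \in box l B.
Proof. by move=> x_l zB; apply: allpairs_f => //; apply: mem_rng. Qed.

Local Notation vec6 := (Z * Z * Z * Z * Z * Z)%type.
Local Notation vec7 := (Z * Z * Z * Z * Z * Z * Z)%type.

Definition box6 B : seq vec6 := box (box (box (box (box (rng B) B) B) B) B) B.

Lemma box6_uniq B : uniq (box6 B).
Proof. by do 5!apply: box_uniq; apply: rng_uniq. Qed.

Lemma box7_uniq B : uniq (box (box6 B) B).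
Proof. exact/box_uniq/box6_uniq. Qed.

(* The entries are the coordinates of a vector of O^3 in the basis 1, alpha of
   O = Z[alpha], where alpha = (1 + sqrt(-7)) / 2. *)
Definition hnorm (y : vec6) : Z :=
  let: (a1, b1, a2, b2, a3, b3) := y in
  (a1 * a1 + a1 * b1 + 2 * b1 * b1) + (a2 * a2 + a2 * b2 + 2 * b2 * b2)
  + (a3 * a3 + a3 * b3 + 2 * b3 * b3).

Definition sphere7 (q : Z) (x : vec7) : bool :=
  let: (x0, x1, x2, x3, x4, x5, x6) := x in
  (x0 + x1 + x2 + x3 + x4 + x5 + x6 == 0) &&
  (x0 * x0 + x1 * x1 + x2 * x2 + x3 * x3 + x4 * x4 + x5 * x5 + x6 * x6 == q).

Lemma mem_box6 q y : hnorm y = q -> y \in box6 (2 * q).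
Proof.
case: y => [[[[[a1 b1] a2] b2] a3] b3] /= <-.
(* Twice the binary form is a^2 + (a + b)^2 + 3 b^2, which bounds both squares. *)
have N_bd a b : 0 <= a * a + a * b + 2 * b * b /\
    - (2 * (a * a + a * b + 2 * b * b)) <= a <= 2 * (a * a + a * b + 2 * b * b)
    /\ - (2 * (a * a + a * b + 2 * b * b)) <= b
         <= 2 * (a * a + a * b + 2 * b * b).
  have le_sq z : - (z * z) <= z <= z * z by nia.
  have := le_sq a; have := le_sq b.
  have := (Z.square_nonneg (a + b), Z.square_nonneg a, Z.square_nonneg b).
  by case=> -[? ?] ?; lia.
move: (N_bd a1 b1) (N_bd a2 b2) (N_bd a3 b3) => H1 H2 H3.
by do 5?[apply: mem_box]; try apply: mem_rng; lia.
Qed.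

Lemma mem_box7 q x : sphere7 q x -> x \in box (box6 q) q.
Proof.
case: x => [[[[[[x0 x1] x2] x3] x4] x5] x6] /= /andP[_ /eqP <-].
have le_sq z : - (z * z) <= z <= z * z by nia.
have := (le_sq x0, le_sq x1, le_sq x2, le_sq x3, le_sq x4, le_sq x5, le_sq x6).
move=> [[[[[[? ?] ?] ?] ?] ?] ?].
by do 6?[apply: mem_box]; try apply: mem_rng; lia.
Qed.

(** The box serves only for finiteness: by [mem_box6] it contains all vectors of norm [q]. *)
Definition num6 (q : Z) (P : pred vec6) : nat :=
  count (fun y => (hnorm y == q) && P y) (box6 (2 * q)).

Definition num7 (q : Z) (P : pred vec7) : nat :=
  count (fun x => sphere7 q x && P x) (box (box6 q) q).

Lemma eq_num6 q (P P' : pred vec6) (r : vec6 -> vec6 -> Prop) q' :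
    (forall y, hnorm y = q -> P y ->
       exists2 y', (hnorm y' == q') && P' y' & r y y') ->
    (forall y', hnorm y' = q' -> P' y' ->
       exists2 y, (hnorm y == q) && P y & r y y') ->
    (forall y y1 y2, r y y1 -> r y y2 -> y1 = y2) ->
    (forall y1 y2 y, r y1 y -> r y2 y -> y1 = y2) ->
  num6 q P = num6 q' P'.
Proof.
move=> tot1 tot2; apply: eq_count_rel; rewrite ?box6_uniq //.
- by move=> y /andP[/eqP/mem_box6].
- by move=> y /andP[/eqP/mem_box6].
- by move=> y /andP[/eqP/tot1].
by move=> y /andP[/eqP/tot2].
Qed.

Lemma eq_num7 q (P P' : pred vec7) (r : vec7 -> vec7 -> Prop) q' :
    (forall x, sphere7 q x -> P x ->
       exists2 x', sphere7 q' x' && P' x' & r x x') ->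
    (forall x', sphere7 q' x' -> P' x' ->
       exists2 x, sphere7 q x && P x & r x x') ->
    (forall x x1 x2, r x x1 -> r x x2 -> x1 = x2) ->
    (forall x1 x2 x, r x1 x -> r x2 x -> x1 = x2) ->
  num7 q P = num7 q' P'.
Proof.
move=> tot1 tot2; apply: eq_count_rel; rewrite ?box7_uniq //.
- by move=> y /andP[/mem_box7].
- by move=> y /andP[/mem_box7].
- by move=> y /andP[/tot1].
by move=> y /andP[/tot2].
Qed.

Lemma eq_num76 q (P : pred vec7) (P' : pred vec6) (r : vec7 -> vec6 -> Prop) q' :
    (forall x, sphere7 q x -> P x ->
       exists2 y, (hnorm y == q') && P' y & r x y) ->
    (forall y, hnorm y = q' -> P' y ->
       exists2 x, sphere7 q x && P x & r x y) ->
    (forall x y1 y2, r x y1 -> r x y2 -> y1 = y2) ->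
    (forall x1 x2 y, r x1 y -> r x2 y -> x1 = x2) ->
  num7 q P = num6 q' P'.
Proof.
move=> tot1 tot2; apply: eq_count_rel; rewrite ?box6_uniq ?box7_uniq //.
- by move=> y /andP[/mem_box7].
- by move=> y /andP[/eqP/mem_box6].
- by move=> y /andP[/tot1].
by move=> y /andP[/eqP/tot2].
Qed.

Lemma num6E q P : num6 q P = (\sum_(y <- box6 (2 * q) | hnorm y == q) P y)%N.
Proof. by rewrite /num6 -sum1_count big_mkcondr /=; apply: eq_bigr => y; case: P. Qed.

Lemma num7E q P : num7 q P = (\sum_(x <- box (box6 q) q | sphere7 q x) P x)%N.
Proof. by rewrite /num7 -sum1_count big_mkcondr /=; apply: eq_bigr => y; case: P. Qed.

(** * Lattices over the integers of Q(sqrt(-7)) *)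

(** Vanishing second differences modulo 7: the residue of x_i is an affine function of i. The
    differences that wrap around then vanish too. *)
Definition affine7 (x : vec7) : bool :=
  let: (x0, x1, x2, x3, x4, x5, x6) := x in
  [&& (x0 - 2 * x1 + x2) mod 7 == 0, (x1 - 2 * x2 + x3) mod 7 == 0,
      (x2 - 2 * x3 + x4) mod 7 == 0, (x3 - 2 * x4 + x5) mod 7 == 0
    & (x4 - 2 * x5 + x6) mod 7 == 0].

(** On affine vectors this is slope 0, the hyperplane to be excluded. *)
Definition flat7 (x : vec7) : bool :=
  let: (x0, x1, x2, x3, x4, x5, x6) := x in (x1 - x0) mod 7 == 0.

(* As a + b alpha is a modulo alpha and a + b modulo its conjugate, these are the
   y in O^3 with y_1 = y_2 = y_3 modulo alpha and y_1 + y_2 + y_3 = 0 modulo the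
   conjugate of alpha. *)
Definition latM (y : vec6) : bool :=
  let: (a1, b1, a2, b2, a3, b3) := y in
  [&& (a2 - a1) mod 2 == 0, (a3 - a1) mod 2 == 0
    & (b1 + b2 + b3 - a1) mod 2 == 0].

(* The sum of ((2 a_k + b_k) p_k + 7 b_k w_k) / 4 over k, for the orthogonal frame
   p_k = balanced residues of (i |-> 2^(k-1) i - 1), w_k = - sqrt(-7) p_k / 7, where
   sqrt(-7) acts on Z^7 by convolution with the Legendre symbol. *)
Definition ofM (y : vec6) : vec7 :=
  let: (a1, b1, a2, b2, a3, b3) := y in
  ((- a1 + 3 * b1 - a2 + 3 * b2 - a3 + 3 * b3) / 2,
   (a2 + 4 * b2 + 3 * a3 - 2 * b3) / 2,
   (a1 + 4 * b1 + 3 * a2 - 2 * b2) / 2,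
   (2 * a1 + b1 - 2 * a2 - b2 - 3 * a3 - 5 * b3) / 2,
   (3 * a1 - 2 * b1 + a3 + 4 * b3) / 2,
   (- 3 * a1 - 5 * b1 + 2 * a2 + b2 - 2 * a3 - b3) / 2,
   (- 2 * a1 - b1 - 3 * a2 - 5 * b2 + 2 * a3 + b3) / 2).

(* The linear form k1 y1 + k2 y2 + k3 y3 modulo sqrt(-7), where alpha = 4. *)
Definition ellform (k1 k2 k3 : Z) (y : vec6) : bool :=
  let: (a1, b1, a2, b2, a3, b3) := y in
  (k1 * (a1 + 4 * b1) + k2 * (a2 + 4 * b2) + k3 * (a3 + 4 * b3)) mod 7 == 0.

Local Notation ell := (ellform 1 2 4).

Lemma mod_exists d a : 0 < d -> a mod d = 0 -> exists k, a = d * k.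
Proof. by move=> d_gt0 /Z.mod_divide[|k ->]; [lia | exists k; lia]. Qed.

Lemma latMP a1 b1 a2 b2 a3 b3 : latM (a1, b1, a2, b2, a3, b3) ->
  exists p q r, [/\ a2 = a1 + 2 * p, a3 = a1 + 2 * q & b3 = a1 - b1 - b2 + 2 * r].
Proof.
case/and3P=> /eqP/mod_exists[//|p hp] /eqP/mod_exists[//|q hq].
by case/eqP/mod_exists=> // r hr; exists p, q, r; split; lia.
Qed.


(** The equations of [ofM] without the division, hence linear. *)
Definition ofM_rel (y : vec6) (x : vec7) : Prop :=
  let: (a1, b1, a2, b2, a3, b3) := y in
  let: (x0, x1, x2, x3, x4, x5, x6) := x in
  (2 * x0 = - a1 + 3 * b1 - a2 + 3 * b2 - a3 + 3 * b3) /\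
  (2 * x1 = a2 + 4 * b2 + 3 * a3 - 2 * b3) /\
  (2 * x2 = a1 + 4 * b1 + 3 * a2 - 2 * b2) /\
  (2 * x3 = 2 * a1 + b1 - 2 * a2 - b2 - 3 * a3 - 5 * b3) /\
  (2 * x4 = 3 * a1 - 2 * b1 + a3 + 4 * b3) /\
  (2 * x5 = - 3 * a1 - 5 * b1 + 2 * a2 + b2 - 2 * a3 - b3) /\
  (2 * x6 = - 2 * a1 - b1 - 3 * a2 - 5 * b2 + 2 * a3 + b3).

Lemma ofM_relP y x : latM y -> ofM_rel y x <-> x = ofM y.
Proof.
case: y x => [[[[[a1 b1] a2] b2] a3] b3] [[[[[[x0 x1] x2] x3] x4] x5] x6].
case/latMP=> p [q [r [-> -> ->]]] /=; split.
  by case=> ? [? [? [? [? [? ?]]]]]; do 6?[apply: (congr2 pair)]; lia.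
by case=> -> -> -> -> -> -> ->; do 6?[split]; lia.
Qed.

Lemma ofM_rel_norm a1 b1 a2 b2 a3 b3 x0 x1 x2 x3 x4 x5 x6 :
    ofM_rel (a1, b1, a2, b2, a3, b3) (x0, x1, x2, x3, x4, x5, x6) ->
    x0 + x1 + x2 + x3 + x4 + x5 + x6 = 0 /\
    x0 * x0 + x1 * x1 + x2 * x2 + x3 * x3 + x4 * x4 + x5 * x5 + x6 * x6
      = 7 * hnorm (a1, b1, a2, b2, a3, b3).
Proof.
move=> /= [h0 [h1 [h2 [h3 [h4 [h5 h6]]]]]]; split; first by lia.
apply: (Z.mul_reg_l _ _ 4) => //.
(* The factor 4 makes the doubled entries appear, which are the ones known as linear forms in
   [y]. *)
transitivity ((2 * x0) * (2 * x0) + (2 * x1) * (2 * x1) + (2 * x2) * (2 * x2)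
  + (2 * x3) * (2 * x3) + (2 * x4) * (2 * x4) + (2 * x5) * (2 * x5)
  + (2 * x6) * (2 * x6)); first by ring.
by rewrite h0 h1 h2 h3 h4 h5 h6; ring.
Qed.

(** Modulo 7, 2 (x_1 - x_0) is the linear form of [ell]. *)
Lemma ofM_slope y : latM y -> flat7 (ofM y) = ell y.
Proof.
move=> My; move: (ofM y) ((ofM_relP (ofM y) My).2 erefl).
case: y {My} => [[[[[a1 b1] a2] b2] a3] b3] [[[[[[x0 x1] x2] x3] x4] x5] x6] /= [h0 [h1 _]]; apply/eqP/eqP; lia.
Qed.

Lemma eq0_mod d k a : a = d * k -> a mod d == 0.
Proof. by move=> ->; rewrite Z.mul_comm Z_mod_mult. Qed.

Lemma eq0_mod7_double k a : 2 * a = 7 * k -> a mod 7 == 0.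
Proof. by move=> h; rewrite (_ : a = (4 * k - a) * 7) ?Z_mod_mult; lia. Qed.

Lemma ofM_affine y : latM y -> affine7 (ofM y).
Proof.
move=> My; move: (ofM y) ((ofM_relP (ofM y) My).2 erefl).
case: y {My} => [[[[[a1 b1] a2] b2] a3] b3] [[[[[[x0 x1] x2] x3] x4] x5] x6] /= [h0 [h1 [h2 [h3 [h4 [h5 h6]]]]]].
apply/and5P; split.
- by apply: (@eq0_mod7_double (b1 - b2 - a3 + b3)); lia.
- by apply: (@eq0_mod7_double (- b1 - a2 + b2 - b3)); lia.
- by apply: (@eq0_mod7_double (a2 + a3 + 2 * b3)); lia.
- by apply: (@eq0_mod7_double (- a1 - a3 - 2 * b3)); lia.
by apply: (@eq0_mod7_double (a1 + b1 - a2 - b2 + a3 + b3)); lia.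
Qed.

Lemma affine7P x0 x1 x2 x3 x4 x5 x6 : affine7 (x0, x1, x2, x3, x4, x5, x6) ->
  exists u k2 k3 k4 k5 k6, x1 = x0 + u /\ x2 = x0 + 2 * u + 7 * k2 /\
     x3 = x0 + 3 * u + 7 * k3 /\ x4 = x0 + 4 * u + 7 * k4 /\
     x5 = x0 + 5 * u + 7 * k5 /\ x6 = x0 + 6 * u + 7 * k6.
Proof.
case/and5P=> /eqP/mod_exists[//|l2 h2] /eqP/mod_exists[//|l3 h3].
case/eqP/mod_exists=> // l4 h4 /eqP/mod_exists[//|l5 h5].
case/eqP/mod_exists=> // l6 h6.
exists (x1 - x0), l2, (l3 + 2 * l2), (l4 + 2 * l3 + 3 * l2).
exists (l5 + 2 * l4 + 3 * l3 + 4 * l2), (l6 + 2 * l5 + 3 * l4 + 4 * l3 + 5 * l2).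
lia.
Qed.


(** By [ofM_rel_norm] the map [ofM] multiplies norms by 7; it is a bijection from M onto the affine
    vectors of sum 0. *)
Lemma num7_ofM m (P : pred vec7) :
  num7 (14 * m) (fun x => affine7 x && P x)
    = num6 (2 * m) (fun y => latM y && P (ofM y)).
Proof.
apply: (eq_num76 (r := fun x y => latM y /\ ofM_rel y x)).
- move=> [[[[[[x0 x1] x2] x3] x4] x5] x6].
  move=> /andP[/eqP s0 /eqP sq] /andP[/affine7P].
  case=> [u [k2 [k3 [k4 [k5 [k6 [e1 [e2 [e3 [e4 [e5 e6]]]]]]]]]]] Px.
  (* The preimage of [x]: [ofM_rel] solved for [y], with x_0 eliminated by the condition that the
     sum is 0. *)
  pose y := (k3 + 2 * k4 - k5 - k6, - u + k2 - k4 - k5,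
             2 * k2 - k3 + k5 - k6, - u - k2 - k6,
             - k3 - k5 + k6, - k3 + k4).
  have My : latM y.
    apply/and3P; split.
    - by apply: (@eq0_mod 2 (k2 - k3 - k4 + k5)); lia.
    - by apply: (@eq0_mod 2 (- k3 - k4 + k6)); lia.
    by apply: (@eq0_mod 2 (- u - k3 - k4)); lia.
  have xy : ofM_rel y (x0, x1, x2, x3, x4, x5, x6) by rewrite /=; lia.
  exists y => //; rewrite My -((ofM_relP _ My).1 xy) Px andbT.
  have eq_norm : 14 * m = 7 * hnorm y by rewrite -sq; exact: (ofM_rel_norm xy).2.
  rewrite andbT; apply/eqP; apply: (Z.mul_reg_l _ _ 7) => //; rewrite -eq_norm; ring.
- move=> y Qy /andP[My Py]; have xy := (ofM_relP (ofM y) My).2 erefl.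
  exists (ofM y) => //; rewrite ofM_affine // Py andbT.
  move: (ofM y) xy; case: y Qy {My Py} => [[[[[a1 b1] a2] b2] a3] b3] Qy [[[[[[x0 x1] x2] x3] x4] x5] x6] /ofM_rel_norm[s0 sq].
  by rewrite andbT /= s0 sq Qy eqxx /=; lia.
- move=> [[[[[[x0 x1] x2] x3] x4] x5] x6] [[[[[a1 b1] a2] b2] a3] b3].
  move=> [[[[[c1 d1] c2] d2] c3] d3] /= [_ h] [_ h'].
  by do 5?[apply: (congr2 pair)]; lia.
by move=> x x' y [My /(ofM_relP _ My)->] [_ /(ofM_relP _ My)->].
Qed.

Lemma eq_in_num6 q (P P' : pred vec6) :
  (forall y, hnorm y = q -> P y = P' y) -> num6 q P = num6 q P'.
Proof.
by move=> eqPP'; apply: eq_count => y; case: eqP => //= /eqPP' ->.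
Qed.

Lemma eq_in_num7 q (P P' : pred vec7) :
  (forall x, sphere7 q x -> P x = P' x) -> num7 q P = num7 q P'.
Proof. 
by move=> eqPP'; apply: eq_count => x; case: (boolP (sphere7 q x)) => //= /eqPP' ->.
 Qed.

Lemma num6_reindex q (f g : vec6 -> vec6) (P : pred vec6) :
    cancel f g -> cancel g f -> (forall y, hnorm (f y) = hnorm y) ->
  num6 q (fun y => P (f y)) = num6 q P.
Proof.
move=> fK gK norm_f; apply: (eq_num6 (r := fun y y' => y' = f y)).
- by move=> y Qy Pfy; exists (f y); rewrite ?norm_f ?Qy ?eqxx.
- by move=> y Qy Py; exists (g y); rewrite ?gK -1?norm_f ?gK ?Qy ?eqxx.
- by move=> y y1 y2 -> ->.
by move=> y1 y2 y -> /(can_inj fK).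
Qed.

Lemma num7_reindex q (f g : vec7 -> vec7) (P : pred vec7) :
    cancel f g -> cancel g f -> (forall x, sphere7 q (f x) = sphere7 q x) ->
  num7 q (fun x => P (f x)) = num7 q P.
Proof.
move=> fK gK norm_f; apply: (eq_num7 (r := fun x x' => x' = f x)).
- by move=> x Qx Pfx; exists (f x); rewrite ?norm_f ?Qx.
- by move=> x Qx Px; exists (g x); rewrite ?gK -1?norm_f ?gK ?Qx.
- by move=> x x1 x2 -> ->.
by move=> x1 x2 x -> /(can_inj fK).
Qed.

Lemma evenP a : ~~ Z.odd a -> exists k, a = 2 * k.
Proof. by rewrite Z.negb_odd => /Z.even_spec. Qed.

Lemma odd_eqP a b : Z.odd a = Z.odd b -> exists k, b = a + 2 * k.
Proof.
move=> ab; have /evenP[k hk] : ~~ Z.odd (b - a) by rewrite Z.odd_sub ab; case: Z.odd.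
by exists k; lia.
Qed.

Lemma Zodd_double k : Z.odd (2 * k) = false.
Proof. by rewrite Z.odd_mul. Qed.

Definition cycO (y : vec6) : vec6 :=
  let: (a1, b1, a2, b2, a3, b3) := y in (a3, b3, a1, b1, a2, b2).

Definition alphaO (y : vec6) : bool :=
  let: (a1, b1, a2, b2, a3, b3) := y in [&& ~~ Z.odd a1, ~~ Z.odd a2 & ~~ Z.odd a3].

Definition twoO (y : vec6) : bool :=
  let: (a1, b1, a2, b2, a3, b3) := y in
  [&& ~~ Z.odd a1, ~~ Z.odd b1, ~~ Z.odd a2, ~~ Z.odd b2, ~~ Z.odd a3 & ~~ Z.odd b3].

(* The neighbours of O^3 given by the lines <e_1> and <e_1 + e_2> of F_2^3; the
   others follow by cyclic permutation, except <e_1 + e_2 + e_3>, which is latM. *)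
Definition axisO (y : vec6) : bool :=
  let: (a1, b1, a2, b2, a3, b3) := y in
  [&& ~~ Z.odd (a1 + b1), ~~ Z.odd a2 & ~~ Z.odd a3].

Definition diagO (y : vec6) : bool :=
  let: (a1, b1, a2, b2, a3, b3) := y in
  [&& Z.odd a1 == Z.odd a2, Z.odd b1 == Z.odd b2 & ~~ Z.odd a3].

Lemma cycOK : cancel cycO (fun y => cycO (cycO y)).
Proof. by case=> [[[[[? ?] ?] ?] ?] ?]. Qed.

Lemma cycO2K : cancel (fun y => cycO (cycO y)) cycO.
Proof. by case=> [[[[[? ?] ?] ?] ?] ?]. Qed.

Lemma hnorm_cycO y : hnorm (cycO y) = hnorm y.
Proof. by case: y => [[[[[? ?] ?] ?] ?] ?] /=; ring. Qed.

(** Nonzero scalars modulo 7 are invertible, which is checked on residues; [d] absorbs the multiples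
    of 7 by which two integral forms differ. *)
Lemma eq0_mod7_scale c d A L :
  c mod 7 <> 0 -> A = c * L + 7 * d -> (A mod 7 == 0) = (L mod 7 == 0).
Proof.
move=> c_n0 ->; rewrite (Z.mul_comm 7) Z_mod_plus_full Z.mul_mod //.
apply/eqP/eqP => [|->]; last by rewrite Z.mul_0_r.
move: (Z.mod_pos_bound L 7 erefl) (Z.mod_pos_bound c 7 erefl) c_n0.
move: (L mod 7) (c mod 7) => l c' l_bd c_bd c_n0.
have: l \in [seq Z.of_nat i | i <- iota 0 7].
  by apply/mapP; exists (Z.to_nat l); rewrite ?mem_iota; lia.
have: c' \in [seq Z.of_nat i | i <- iota 1 6].
  by apply/mapP; exists (Z.to_nat c'); rewrite ?mem_iota; lia.
rewrite !inE.
by do 5?[case/orP]; move=> /eqP->; do 6?[case/orP]; move=> /eqP->.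
Qed.

Lemma num6_similar c q (f : vec6 -> vec6) (P P' : pred vec6) :
    0 < c -> injective f -> (forall y, hnorm (f y) = c * hnorm y) ->
    (forall y, P (f y) = P' y) -> (forall y, P y -> exists y', y = f y') ->
  num6 (c * q) P = num6 q P'.
Proof.
move=> c_gt0 inj_f norm_f Pf im_f; symmetry.
apply: (eq_num6 (r := fun y y' => y' = f y)).
- by move=> y <- P'y; exists (f y); rewrite // norm_f Pf P'y eqxx.
- move=> y Qy Py; have [y' def_y] := im_f y Py; exists y' => //.
  rewrite -Pf -def_y Py andbT; apply/eqP/(Z.mul_reg_l _ _ c); first lia.
  by rewrite -norm_f -def_y.
- by move=> y y1 y2 -> ->.
by move=> y1 y2 y -> /inj_f.
Qed.

(** Doubling modulo 7 permutes the coefficients 1, 2, 4 cyclically. *)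
Lemma ell_cycO y : ell (cycO y) = ell y.
Proof.
case: y => [[[[[a1 b1] a2] b2] a3] b3] /=.
by apply: (@eq0_mod7_scale 2 (- (a3 + 4 * b3))); lia.
Qed.

Lemma num6_cycO q (P : pred vec6) :
  num6 q (fun y => ~~ ell y && P (cycO y)) = num6 q (fun y => ~~ ell y && P y).
Proof.
rewrite -(num6_reindex q (fun y => ~~ ell y && P y) cycOK cycO2K hnorm_cycO).
by apply: eq_in_num6 => y _; rewrite ell_cycO.
Qed.

(** * Neighbours at 2 *)

Lemma num6_axisO m :
  num6 (2 * m) (fun y => ~~ ell y && axisO y) = num6 m (fun y => ~~ ell y).
Proof.
(* Multiplication by the conjugate of alpha on y_1 and by alpha on y_2 and y_3. Both are 4 modulo
   sqrt(-7), so the form of [ell] is multiplied by 4. *)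
pose f (y : vec6) := let: (a1, b1, a2, b2, a3, b3) := y in
  (a1 + 2 * b1, - a1, - 2 * b2, a2 + b2, - 2 * b3, a3 + b3).
apply: (@num6_similar 2 m f) => //.
- move=> [[[[[a1 b1] a2] b2] a3] b3] [[[[[c1 d1] c2] d2] c3] d3] [].
  by move=> *; do 5?[apply: (congr2 pair)]; lia.
- by move=> [[[[[a1 b1] a2] b2] a3] b3] /=; ring.
- move=> [[[[[a1 b1] a2] b2] a3] b3] /=.
  rewrite (@eq0_mod7_scale 4 (- a1 - 2 * b1 - 4 * b2 - 8 * b3) _
    (1 * (a1 + 4 * b1) + 2 * (a2 + 4 * b2) + 4 * (a3 + 4 * b3))) //; last by lia.
  by rewrite (_ : _ + - a1 = 2 * b1) ?Zodd_double ?Z.odd_mul ?andbT //; ring.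
move=> [[[[[a1 b1] a2] b2] a3] b3] /andP[_] /and3P[/evenP[k1 h1] /evenP[k2 h2] /evenP[k3 h3]].
exists (- b1, k1, b2 + k2, - k2, b3 + k3, - k3); rewrite /f.
by do 5?[apply: (congr2 pair)]; lia.
Qed.

Lemma num6_diagO m :
  num6 (2 * m) (fun y => ~~ ell y && diagO y) = num6 m (fun y => ~~ ell y).
Proof.
(* The vector (y_1 + y_2, y_1 - y_2, - alpha y_3), on which the form of [ell] is 3 times its value
   at y. *)
pose f (y : vec6) := let: (a1, b1, a2, b2, a3, b3) := y in
  (a1 + a2, b1 + b2, a1 - a2, b1 - b2, 2 * b3, - a3 - b3).
apply: (@num6_similar 2 m f) => //.
- move=> [[[[[a1 b1] a2] b2] a3] b3] [[[[[c1 d1] c2] d2] c3] d3] [].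
  by move=> *; do 5?[apply: (congr2 pair)]; lia.
- by move=> [[[[[a1 b1] a2] b2] a3] b3] /=; ring.
- move=> [[[[[a1 b1] a2] b2] a3] b3] /=.
  rewrite (@eq0_mod7_scale 3 (- (a2 + 4 * b2) - 4 * a3 - 8 * b3) _
    (1 * (a1 + 4 * b1) + 2 * (a2 + 4 * b2) + 4 * (a3 + 4 * b3))) //; last by lia.
  by rewrite !Z.odd_sub !Z.odd_add !eqxx Zodd_double andbT.
move=> [[[[[a1 b1] a2] b2] a3] b3] /andP[_].
case/and3P=> /eqP/odd_eqP[k1 h1] /eqP/odd_eqP[k2 h2] /evenP[k3 h3].
exists (a1 + k1, b1 + k2, - k1, - k2, - b3 - k3, k3); rewrite /f.
by do 5?[apply: (congr2 pair)]; lia.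
Qed.

Lemma num6_alphaO m :
  num6 (2 * m) (fun y => ~~ ell y && alphaO y) = num6 m (fun y => ~~ ell y).
Proof.
(* Multiplication by - alpha, which is 3 modulo sqrt(-7). *)
pose f (y : vec6) := let: (a1, b1, a2, b2, a3, b3) := y in
  (2 * b1, - a1 - b1, 2 * b2, - a2 - b2, 2 * b3, - a3 - b3).
apply: (@num6_similar 2 m f) => //.
- move=> [[[[[a1 b1] a2] b2] a3] b3] [[[[[c1 d1] c2] d2] c3] d3] [].
  by move=> *; do 5?[apply: (congr2 pair)]; lia.
- by move=> [[[[[a1 b1] a2] b2] a3] b3] /=; ring.
- move=> [[[[[a1 b1] a2] b2] a3] b3] /=.
  rewrite (@eq0_mod7_scale 3 (- a1 - 2 * b1 - 2 * a2 - 4 * b2 - 4 * a3 - 8 * b3) _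
    (1 * (a1 + 4 * b1) + 2 * (a2 + 4 * b2) + 4 * (a3 + 4 * b3))) //; last by lia.
  by rewrite !Zodd_double andbT.
move=> [[[[[a1 b1] a2] b2] a3] b3] /andP[_].
case/and3P=> /evenP[k1 h1] /evenP[k2 h2] /evenP[k3 h3].
exists (- b1 - k1, k1, - b2 - k2, k2, - b3 - k3, k3); rewrite /f.
by do 5?[apply: (congr2 pair)]; lia.
Qed.

Lemma num6_twoO m (P P' : pred vec6) :
    (forall a1 b1 a2 b2 a3 b3, P (2 * a1, 2 * b1, 2 * a2, 2 * b2, 2 * a3, 2 * b3)
       = P' (a1, b1, a2, b2, a3, b3)) ->
  num6 (4 * m) (fun y => P y && twoO y) = num6 m P'.
Proof.
move=> PP'; pose f (y : vec6) := let: (a1, b1, a2, b2, a3, b3) := y in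
  (2 * a1, 2 * b1, 2 * a2, 2 * b2, 2 * a3, 2 * b3).
apply: (@num6_similar 4 m f) => //.
- move=> [[[[[a1 b1] a2] b2] a3] b3] [[[[[c1 d1] c2] d2] c3] d3] [].
  by move=> *; do 5?[apply: (congr2 pair)]; lia.
- by move=> [[[[[a1 b1] a2] b2] a3] b3] /=; ring.
- by move=> [[[[[a1 b1] a2] b2] a3] b3] /=; rewrite PP' !Zodd_double andbT.
move=> [[[[[a1 b1] a2] b2] a3] b3] /andP[_].
case/andP=> /evenP[k1 h1] /andP[/evenP[l1 e1]] /and4P[].
move=> /evenP[k2 h2] /evenP[l2 e2] /evenP[k3 h3] /evenP[l3 e3].
exists (k1, l1, k2, l2, k3, l3); rewrite /f.
by do 5?[apply: (congr2 pair)]; lia.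
Qed.

Lemma num6_twoO_odd q (P : pred vec6) :
  q mod 4 <> 0 -> num6 q (fun y => P y && twoO y) = 0%N.
Proof.
move=> q4; apply/eqP; rewrite -leqn0 leqNgt -has_count; apply/hasPn => y _ /=.
apply/negP=> /and3P[/eqP Qy _].
case: y Qy => [[[[[a1 b1] a2] b2] a3] b3] Qy.
case/andP=> /evenP[k1 h1] /andP[/evenP[l1 e1]] /and4P[].
move=> /evenP[k2 h2] /evenP[l2 e2] /evenP[k3 h3] /evenP[l3 e3].
apply: q4; rewrite -Qy h1 e1 h2 e2 h3 e3.
rewrite (_ : hnorm _ = hnorm (k1, l1, k2, l2, k3, l3) * 4) ?Z_mod_mult //=; ring.
Qed.


Lemma eq0_mod2 a : (a mod 2 == 0) = ~~ Z.odd a.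
Proof. by rewrite Zmod_odd; case: Z.odd. Qed.

(** Incidences between vectors and the seven neighbours. A vector of even norm lies in all seven if
    it is in 2 O^3, in three if it is in alpha O^3 but not in 2 O^3, and in exactly one otherwise;
    hence the weights 1, 2, 4 on the left. *)
Lemma hecke_O m :
  (num6 (2 * m) (fun y => ~~ ell y) + 2 * num6 m (fun y => ~~ ell y)
    + 4 * num6 (2 * m) (fun y => ~~ ell y && twoO y)
  = 6 * num6 m (fun y => ~~ ell y) + num6 (2 * m) (fun y => ~~ ell y && latM y))%N.
Proof.
have axis1 := num6_axisO m; have diag1 := num6_diagO m.
have axis2 := num6_cycO (2 * m) axisO; have diag2 := num6_cycO (2 * m) diagO.
have axis3 := num6_cycO (2 * m) (fun y => axisO (cycO y)).
have diag3 := num6_cycO (2 * m) (fun y => diagO (cycO y)).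
rewrite axis2 axis1 in axis3; rewrite axis1 in axis2.
rewrite diag2 diag1 in diag3; rewrite diag1 in diag2.
have -> : (6 * num6 m (fun y => ~~ ell y) =
    num6 m (fun y => ~~ ell y) + num6 m (fun y => ~~ ell y)
    + num6 m (fun y => ~~ ell y) + (num6 m (fun y => ~~ ell y)
    + num6 m (fun y => ~~ ell y) + num6 m (fun y => ~~ ell y)))%N by lia.
rewrite -{2}axis1 -{2}axis2 -{2}axis3 -{2}diag1 -{2}diag2 -{2}diag3 -(num6_alphaO m).
rewrite !num6E !big_distrr -!big_split /=. apply: eq_bigr => y.
case: y => [[[[[a1 b1] a2] b2] a3] b3] /eqP Qy.
have {Qy} : Z.odd (hnorm (a1, b1, a2, b2, a3, b3)) = false by rewrite Qy Zodd_double.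
rewrite /latM !eq0_mod2 /= !Z.odd_sub !Z.odd_add !Z.odd_mul.
case: (_ mod 7 == 0) => //=.
by case: (Z.odd a1) (Z.odd b1) (Z.odd a2) (Z.odd b2) (Z.odd a3) (Z.odd b3) => [] [] [] [] [] [].
Qed.

(** * Symmetries of M in Z^7, and its neighbours *)

Lemma num7_similar c q (f : vec7 -> vec7) (P P' : pred vec7) :
    injective f -> (forall x, sphere7 (c * q) (f x) = sphere7 q x) ->
    (forall x, sphere7 q x -> P' x -> P (f x)) ->
    (forall x, sphere7 (c * q) x -> P x -> exists2 x', x = f x' & P' x') ->
  num7 (c * q) P = num7 q P'.
Proof.
move=> inj_f sph_f Pf im_f; symmetry.
apply: (eq_num7 (r := fun x x' => x' = f x)).
- by move=> x qx P'x; exists (f x); rewrite // sph_f qx Pf.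
- move=> x qx Px; have [x' def_x P'x'] := im_f x qx Px; exists x' => //.
  by rewrite P'x' -sph_f -def_x qx.
- by move=> x x1 x2 -> ->.
by move=> x1 x2 x -> /inj_f.
Qed.

Definition shift7 (x : vec7) : vec7 :=
  let: (x0, x1, x2, x3, x4, x5, x6) := x in (x1, x2, x3, x4, x5, x6, x0).

(** The index map i -> 3 i. As 3 generates the units modulo 7, [mul7] and [shift7] generate all 42
    affine changes of the index. *)
Definition mul7 (x : vec7) : vec7 :=
  let: (x0, x1, x2, x3, x4, x5, x6) := x in (x0, x3, x6, x2, x5, x1, x4).

Definition slanted (x : vec7) : bool := affine7 x && ~~ flat7 x.

Lemma affine7W (x0 x1 x2 x3 x4 x5 x6 u k2 k3 k4 k5 k6 : Z) :
    x1 = x0 + u -> x2 = x0 + 2 * u + 7 * k2 ->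
     x3 = x0 + 3 * u + 7 * k3 -> x4 = x0 + 4 * u + 7 * k4 ->
     x5 = x0 + 5 * u + 7 * k5 -> x6 = x0 + 6 * u + 7 * k6 ->
  affine7 (x0, x1, x2, x3, x4, x5, x6).
Proof.
move=> -> -> -> -> -> ->; apply/and5P; split.
- by apply: (@eq0_mod 7 k2); ring.
- by apply: (@eq0_mod 7 (k3 - 2 * k2)); ring.
- by apply: (@eq0_mod 7 (k4 - 2 * k3 + k2)); ring.
- by apply: (@eq0_mod 7 (k5 - 2 * k4 + k3)); ring.
by apply: (@eq0_mod 7 (k6 - 2 * k5 + k4)); ring.
Qed.

Lemma slanted_shift7W x : slanted x -> slanted (shift7 x).
Proof.
move: x => [[[[[[x0 x1] x2] x3] x4] x5] x6] /andP[/affine7P].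
move=> [u [k2 [k3 [k4 [k5 [k6 [e1 [e2 [e3 [e4 [e5 e6]]]]]]]]]]] slope.
apply/andP; split; first by apply: (@affine7W _ _ _ _ _ _ _ (u + 7 * k2)
  (k3 - 2 * k2) (k4 - 3 * k2) (k5 - 4 * k2) (k6 - 5 * k2) (- u - 6 * k2)); lia.
by move: slope; rewrite /= (@eq0_mod7_scale 1 k2 _ (x1 - x0)) //; lia.
Qed.

Lemma shift7K : cancel shift7 (iter 6 shift7).
Proof. by case=> [[[[[[? ?] ?] ?] ?] ?] ?]. Qed.

Lemma shift7Kr : cancel (iter 6 shift7) shift7.
Proof. by case=> [[[[[[? ?] ?] ?] ?] ?] ?]. Qed.

Lemma slanted_shift7 x : slanted (shift7 x) = slanted x.
Proof.
apply/idP/idP => [|/slanted_shift7W//]; rewrite -{2}[x]shift7K.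
by move=> sx; do 6!apply: slanted_shift7W.
Qed.

Lemma sphere7_shift7 q x : sphere7 q (shift7 x) = sphere7 q x.
Proof.
by case: x => [[[[[[x0 x1] x2] x3] x4] x5] x6] /=; rewrite !eq_op_Z; congr (_ && _); congr (_ =? _); ring.
Qed.

Lemma num7_shift7 q (P : pred vec7) :
  num7 q (fun x => slanted x && P (shift7 x)) = num7 q (fun x => slanted x && P x).
Proof.
rewrite -(num7_reindex (fun x => slanted x && P x) shift7K shift7Kr); last first.
  by move=> x; rewrite sphere7_shift7.
by apply: eq_in_num7 => x _; rewrite slanted_shift7.
Qed.

Lemma slanted_mul7W x : slanted x -> slanted (mul7 x).
Proof.
move: x => [[[[[[x0 x1] x2] x3] x4] x5] x6] /andP[/affine7P].
move=> [u [k2 [k3 [k4 [k5 [k6 [e1 [e2 [e3 [e4 [e5 e6]]]]]]]]]]] slope.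
apply/andP; split; first by apply: (@affine7W _ _ _ _ _ _ _ (3 * u + 7 * k3)
  (k6 - 2 * k3) (k2 - 3 * k3 - u) (k5 - 4 * k3 - u) (- 5 * k3 - 2 * u)
  (k4 - 6 * k3 - 2 * u)); lia.
by move: slope; rewrite /= (@eq0_mod7_scale 3 k3 _ (x1 - x0)) //; lia.
Qed.

Lemma mul7K : cancel mul7 (iter 5 mul7).
Proof. by case=> [[[[[[? ?] ?] ?] ?] ?] ?]. Qed.

Lemma mul7Kr : cancel (iter 5 mul7) mul7.
Proof. by case=> [[[[[[? ?] ?] ?] ?] ?] ?]. Qed.

Lemma slanted_mul7 x : slanted (mul7 x) = slanted x.
Proof.
apply/idP/idP => [|/slanted_mul7W//]; rewrite -{2}[x]mul7K.
by move=> sx; do 5!apply: slanted_mul7W.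
Qed.

Lemma sphere7_mul7 q x : sphere7 q (mul7 x) = sphere7 q x.
Proof.
by case: x => [[[[[[x0 x1] x2] x3] x4] x5] x6] /=; rewrite !eq_op_Z; congr (_ && _); congr (_ =? _); ring.
Qed.

Lemma num7_mul7 q (P : pred vec7) :
  num7 q (fun x => slanted x && P (mul7 x)) = num7 q (fun x => slanted x && P x).
Proof.
rewrite -(num7_reindex (fun x => slanted x && P x) mul7K mul7Kr); last first.
  by move=> x; rewrite sphere7_mul7.
by apply: eq_in_num7 => x _; rewrite slanted_mul7.
Qed.

(* Multiplication by zeta + zeta^2 + zeta^4 in Z[zeta], zeta^7 = 1, a similarity
   of norm 2 on vectors of sum 0. *)
Definition alpha7 (x : vec7) : vec7 :=
  let: (x0, x1, x2, x3, x4, x5, x6) := x in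
  (x1 + x2 + x4, x2 + x3 + x5, x3 + x4 + x6, x4 + x5 + x0, x5 + x6 + x1,
   x6 + x0 + x2, x0 + x1 + x3).

Definition even7 (x : vec7) : bool :=
  let: (x0, x1, x2, x3, x4, x5, x6) := x in
  [&& ~~ Z.odd x0, ~~ Z.odd x1, ~~ Z.odd x2, ~~ Z.odd x3, ~~ Z.odd x4, ~~ Z.odd x5
    & ~~ Z.odd x6].

Lemma even7P x0 x1 x2 x3 x4 x5 x6 : even7 (x0, x1, x2, x3, x4, x5, x6) ->
  exists k0 k1 k2 k3 k4 k5 k6, [/\ x0 = 2 * k0, x1 = 2 * k1, x2 = 2 * k2
    & [/\ x3 = 2 * k3, x4 = 2 * k4, x5 = 2 * k5 & x6 = 2 * k6]].
Proof.
case/and4P=> /evenP[k0 h0] /evenP[k1 h1] /evenP[k2 h2].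
case/and4P=> /evenP[k3 h3] /evenP[k4 h4] /evenP[k5 h5] /evenP[k6 h6].
by exists k0, k1, k2, k3, k4, k5, k6.
Qed.

Definition nodd7 (x : vec7) : nat :=
  let: (x0, x1, x2, x3, x4, x5, x6) := x in
  (Z.odd x0 + Z.odd x1 + Z.odd x2 + Z.odd x3 + Z.odd x4 + Z.odd x5 + Z.odd x6)%N.

Lemma sqr_odd a : exists k, a * a = Z.of_nat (Z.odd a) + 4 * k.
Proof.
case a_odd: (Z.odd a); last first.
  by have /evenP[k ->] := negbT a_odd; exists (k * k); lia.
by have /Z.odd_spec[k ->] := a_odd; exists (k * k + k); lia.
Qed.

(** A square is 0 or 1 modulo 4 according to parity. *)
Lemma sphere7_nodd7 q x : sphere7 q x -> exists k, q = Z.of_nat (nodd7 x) + 4 * k.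
Proof.
case: x => [[[[[[x0 x1] x2] x3] x4] x5] x6] /andP[_ /eqP <-].
have [[k0 ->] [k1 ->]] := (sqr_odd x0, sqr_odd x1).
have [[k2 ->] [k3 ->]] := (sqr_odd x2, sqr_odd x3).
have [[[k4 ->] [k5 ->]] [k6 ->]] := (sqr_odd x4, sqr_odd x5, sqr_odd x6).
by exists (k0 + k1 + k2 + k3 + k4 + k5 + k6); rewrite /nodd7; lia.
Qed.

(** The conjugate of [alpha7]. On vectors of sum 0 their composite is doubling, so the image of
    [alpha7] is recognised by the evenness of [alphabar7]. *)
Definition alphabar7 (x : vec7) : vec7 :=
  let: (x0, x1, x2, x3, x4, x5, x6) := x in
  (x6 + x5 + x3, x0 + x6 + x4, x1 + x0 + x5, x2 + x1 + x6, x3 + x2 + x0,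
   x4 + x3 + x1, x5 + x4 + x2).

Lemma slanted_alpha7 x : slanted x -> slanted (alpha7 x).
Proof.
move: x => [[[[[[x0 x1] x2] x3] x4] x5] x6] /andP[/affine7P].
move=> [u [k2 [k3 [k4 [k5 [k6 [e1 [e2 [e3 [e4 [e5 e6]]]]]]]]]]] slope.
apply/andP; split; first by apply: (@affine7W _ _ _ _ _ _ _
  (3 * u + 7 * (k3 - k4 + k5)) (- k2 - k3 + 2 * k4 - 2 * k5 + k6)
  (- u - k2 - 3 * k3 + 3 * k4 - 2 * k5) (- u - k2 - 4 * k3 + 3 * k4 - 3 * k5 + k6)
  (- 2 * u - 5 * k3 + 4 * k4 - 5 * k5 + k6)
  (- 3 * u - k2 - 5 * k3 + 5 * k4 - 6 * k5)); lia.
by move: slope; rewrite /= (@eq0_mod7_scale 3 (k3 - k4 + k5) _ (x1 - x0)) //; lia.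
Qed.

Lemma num7_alphabar7 q :
  num7 (2 * q) (fun x => slanted x && even7 (alphabar7 x)) = num7 q slanted.
Proof.
apply: (@num7_similar 2 q alpha7).
- move=> [[[[[[x0 x1] x2] x3] x4] x5] x6] [[[[[[y0 y1] y2] y3] y4] y5] y6] [].
  by move=> *; do 6?[apply: (congr2 pair)]; lia.
- move=> [[[[[[x0 x1] x2] x3] x4] x5] x6]; rewrite /sphere7 /alpha7.
  set s := x0 + x1 + x2 + x3 + x4 + x5 + x6.
  rewrite !eq_op_Z (_ : _ + _ + (x0 + x1 + x3) = 3 * s); last by rewrite /s; ring.
  set n := x0 * x0 + _ + _ + _ + _ + _ + _; set n' := _ + _ * (x0 + x1 + x3).
  have -> : n' = 2 * n + s * s by rewrite /n' /n /s; ring.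
  by move: s n => s n; apply/andP/andP => -[/Z.eqb_spec ? /Z.eqb_spec ?];
    have s0 : s = 0 by [lia]; split; apply/Z.eqb_spec; rewrite ?s0; lia.
- move=> x sph_x sx; rewrite slanted_alpha7 //=.
  move: x sph_x {sx} => [[[[[[x0 x1] x2] x3] x4] x5] x6] /andP[/eqP s0 _].
  have -> : alphabar7 (alpha7 (x0, x1, x2, x3, x4, x5, x6))
    = (2 * x0, 2 * x1, 2 * x2, 2 * x3, 2 * x4, 2 * x5, 2 * x6).
    by do 6?[apply: (congr2 pair)]; lia.
  by rewrite /even7 !Zodd_double.
move=> [[[[[[x0 x1] x2] x3] x4] x5] x6] /andP[/eqP s0 _] /andP[/andP[/affine7P]].
move=> [u [k2 [k3 [k4 [k5 [k6 [e1 [e2 [e3 [e4 [e5 e6]]]]]]]]]]] slope.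
case/even7P=> h0 [h1 [h2 [h3 [h4 [h5 [h6 [f0 f1 f2 [f3 f4 f5 f6]]]]]]]].
(* The preimage under [alpha7] is half of [alphabar7 x]. *)
exists (h0, h1, h2, h3, h4, h5, h6).
  by do 6?[apply: (congr2 pair)]; lia.
apply/andP; split.
  apply/and5P; split.
  - by apply: (@eq0_mod7_double (k3 - 2 * k4 + 2 * k5 - k6)); lia.
  - by apply: (@eq0_mod7_double (u + k2 + k4 - 2 * k5 + 2 * k6)); lia.
  - by apply: (@eq0_mod7_double (- u - k2 + k3 + k5 - 2 * k6)); lia.
  - by apply: (@eq0_mod7_double (u - k2 - k3 + k4 + k6)); lia.
  by apply: (@eq0_mod7_double (2 * k2 - k3 - k4 + k5)); lia.
(* [alphabar7] multiplies the slope by 3, and -16 is 3 / 2 modulo 7. *)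
move: slope; rewrite /= -(@eq0_mod7_scale (- 16)
  (- 4 * k3 + 4 * k4 - 4 * k5 - (h1 - h0)) (h1 - h0)) //; lia.
Qed.

(** Three applications of [mul7] send i to 27 i = - i, which exchanges [alpha7] and [alphabar7]. *)
Lemma num7_alpha7 q :
  num7 (2 * q) (fun x => slanted x && even7 (alpha7 x)) = num7 q slanted.
Proof.
rewrite -num7_alphabar7 -(num7_mul7 _ (fun x => even7 (alpha7 x))).
rewrite -(num7_mul7 _ (fun x => even7 (alpha7 (mul7 x)))).
rewrite -(num7_mul7 _ (fun x => even7 (alpha7 (mul7 (mul7 x))))).
apply: eq_in_num7 => -[[[[[[x0 x1] x2] x3] x4] x5] x6] _; congr (_ && _).
rewrite /= !Z.odd_add.
by case: (Z.odd x0) (Z.odd x1) (Z.odd x2) (Z.odd x3) (Z.odd x4) (Z.odd x5)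
         (Z.odd x6) => [] [] [] [] [] [] [].
Qed.

Lemma num7_even7 q :
  num7 (4 * q) (fun x => slanted x && even7 x) = num7 q slanted.
Proof.
pose f (x : vec7) : vec7 := let: (x0, x1, x2, x3, x4, x5, x6) := x in
  (2 * x0, 2 * x1, 2 * x2, 2 * x3, 2 * x4, 2 * x5, 2 * x6).
have slanted_f x : slanted (f x) = slanted x.
  case: x => [[[[[[x0 x1] x2] x3] x4] x5] x6]; rewrite /slanted /=.
  by congr ((_ && _) && ~~ _); [|do 4?congr (_ && _)|];
    apply: (@eq0_mod7_scale 2 0) => //; ring.
apply: (@num7_similar 4 q f).
- move=> [[[[[[x0 x1] x2] x3] x4] x5] x6] [[[[[[y0 y1] y2] y3] y4] y5] y6] [].
  by move=> *; do 6?[apply: (congr2 pair)]; lia.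
- move=> [[[[[[x0 x1] x2] x3] x4] x5] x6]; rewrite /= !eq_op_Z.
  by congr (_ && _); apply/Z.eqb_spec/Z.eqb_spec; lia.
- move=> x _ sx; rewrite slanted_f sx.
  by case: x {sx} => [[[[[[x0 x1] x2] x3] x4] x5] x6]; rewrite /= !Zodd_double.
move=> [[[[[[x0 x1] x2] x3] x4] x5] x6] _ /andP[sx].
case/even7P=> h0 [h1 [h2 [h3 [h4 [h5 [h6 [f0 f1 f2 [f3 f4 f5 f6]]]]]]]].
have fh: f (h0, h1, h2, h3, h4, h5, h6) = (x0, x1, x2, x3, x4, x5, x6).
  by rewrite /f f0 f1 f2 f3 f4 f5 f6.
by exists (h0, h1, h2, h3, h4, h5, h6); [rewrite fh | rewrite -slanted_f fh].
Qed.

Lemma num7_odd q P : Z.odd q -> num7 q P = 0%N.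
Proof.
move=> q_odd; apply/eqP; rewrite -leqn0 leqNgt -has_count; apply/hasPn => x _ /=.
case: x => [[[[[[x0 x1] x2] x3] x4] x5] x6] /=.
apply/negP => /andP[/andP[/eqP s0 /eqP sq] _]; move: q_odd; rewrite -sq.
move: (congr1 Z.odd s0); rewrite !Z.odd_add !Z.odd_mul.
by case: (Z.odd x0) (Z.odd x1) (Z.odd x2) (Z.odd x3) (Z.odd x4) (Z.odd x5)
         (Z.odd x6) => [] [] [] [] [] [] [].
Qed.

(* The image of 2 O^3 under ofM; its seven shifts are the neighbours of M. *)
Definition twoM (x : vec7) : bool :=
  let: (x0, x1, x2, x3, x4, x5, x6) := x in
  [&& ~~ Z.odd (x1 + x2 + x4), ~~ Z.odd (x0 + x2 + x3) & ~~ Z.odd (x0 + x1 + x5)].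

Lemma num7_ofM_slanted m (P : pred vec7) :
  num7 (14 * m) (fun x => slanted x && P x)
    = num6 (2 * m) (fun y => ~~ ell y && (latM y && P (ofM y))).
Proof.
under eq_in_num7 => x _ do rewrite -andbA.
rewrite (num7_ofM m (fun x => ~~ flat7 x && P x)).
apply: eq_in_num6 => y _; case My: (latM y); last by rewrite andbF.
by rewrite (ofM_slope My).
Qed.

Lemma num7_twoM m :
  num7 (14 * (2 * m)) (fun x => slanted x && twoM x) = num6 m (fun y => ~~ ell y).
Proof.
rewrite num7_ofM_slanted -(@num6_twoO m (fun y => ~~ ell y)); last first.
  move=> a1 b1 a2 b2 a3 b3 /=; congr (~~ _).
  by apply: (@eq0_mod7_scale 2 0) => //; ring.
rewrite (_ : 2 * (2 * m) = 4 * m); last by ring.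
apply: eq_in_num6 => y _; congr (_ && _).
have [My|] := boolP (latM y); last first.
  case: y => [[[[[a1 b1] a2] b2] a3] b3]; rewrite /= !eq0_mod2.
  rewrite !Z.odd_sub !Z.odd_add.
  by case: (Z.odd a1) (Z.odd b1) (Z.odd a2) (Z.odd b2) (Z.odd a3) (Z.odd b3)
    => [] [] [] [] [] [].
move: (ofM y) ((ofM_relP (ofM y) My).2 erefl).
case: y My => [[[[[a1 b1] a2] b2] a3] b3] My.
case=> [[[[[[x0 x1] x2] x3] x4] x5] x6] /= [h0 [h1 [h2 [h3 [h4 [h5 h6]]]]]].
(* Modulo 2 the three sums are b_1 + b_2 + b_3, a_1 + b_3 and a_2 + b_1. On M they all vanish only
   if all six coordinates are even. *)
rewrite (_ : x1 + x2 + x4 = 2 * (a1 + a2 + a3) + (b1 + b2 + b3)); last by lia.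
rewrite (_ : x0 + x2 + x3 = 2 * (2 * b1 - a3) + a1 - b3); last by lia.
rewrite (_ : x0 + x1 + x5 = 2 * (- a1 + 2 * b2) + a2 - b1); last by lia.
move: My; rewrite /latM !eq0_mod2 !Z.odd_sub !Z.odd_add !Zodd_double.
by case: (Z.odd a1) (Z.odd b1) (Z.odd a2) (Z.odd b2) (Z.odd a3) (Z.odd b3)
    => [] [] [] [] [] [].
Qed.

(** Such a vector of norm 28 m has 0 or 4 odd entries. It lies in all seven shifts of [twoM] if it
    is even, in three if only its image under [alphabar7] is, and in one otherwise. For the
    inequality, 4 = 3 + 1: three copies are placed where [alphabar7] is even and one where [alpha7]
    is; both hold only for even vectors, where 3 + 1 + 3 = 7. *)
Lemma hecke_M m :
  (num7 (14 * (2 * m)) slanted + 2 * num7 (14 * m) slanted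
    + 4 * num7 (14 * (2 * m)) (fun x => slanted x && even7 x)
  = 7 * num6 m (fun y => ~~ ell y))%N
  /\ (4 * num7 (14 * m) slanted
    + 3 * num7 (14 * (2 * m)) (fun x => slanted x && even7 x)
  <= 7 * num6 m (fun y => ~~ ell y))%N.
Proof.
pose q := 14 * (2 * m); have def_q : q = 2 * (14 * m) by rewrite /q; ring.
pose n j := num7 q (fun x => slanted x && twoM (iter j shift7 x)).
have n0 j : n j = num6 m (fun y => ~~ ell y).
  elim: j => [|j <-]; first exact: num7_twoM.
  rewrite /n -[RHS](num7_shift7 _ (fun x => twoM (iter j shift7 x))).
  by apply: eq_in_num7 => x _; rewrite -iterSr.
have -> : (7 * num6 m (fun y => ~~ ell y)
    = n 0 + n 1 + n 2 + n 3 + n 4 + n 5 + n 6)%N by rewrite !n0; lia.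
have alpha := num7_alpha7 (14 * m); have alphabar := num7_alphabar7 (14 * m).
have split4 : (4 * num7 (14 * m) slanted
    = 3 * num7 (14 * m) slanted + num7 (14 * m) slanted)%N by lia.
rewrite split4 -{3}alpha -{1}alphabar -{1}alphabar -/q -def_q /n.
rewrite !num7E !big_distrr -!big_split /=.
have nodd_q x : sphere7 q x -> (nodd7 x %% 4 == 0)%N.
  by case/sphere7_nodd7=> k; rewrite /q; lia.
split; [apply: eq_bigr | apply: leq_sum]; move=> x /nodd_q; case: slanted => //=;
  case: x => [[[[[[x0 x1] x2] x3] x4] x5] x6]; rewrite /= !Z.odd_add;
  by case: (Z.odd x0) (Z.odd x1) (Z.odd x2) (Z.odd x3) (Z.odd x4) (Z.odd x5)
         (Z.odd x6) => [] [] [] [] [] [] [].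
Qed.

(** * Nonresidues modulo 7 *)

(* An isometry from O^3 to another lattice containing 7 A_6^*, which restricts to
   an isometry between the sections of O^3 and of M by the hyperplane ell. *)
Definition ofY (y : vec6) : vec7 :=
  let: (a1, b1, a2, b2, a3, b3) := y in
  (- 2 * a1 - b1 + a2 + 4 * b2, - 2 * a1 - b1 + a2 - 3 * b2,
   - 2 * a2 - b2 + a3 + 4 * b3, - 2 * a2 - b2 + a3 - 3 * b3,
   a1 + 4 * b1 - 2 * a3 - b3, a1 - 3 * b1 - 2 * a3 - b3,
   2 * a1 + b1 + 2 * a2 + b2 + 2 * a3 + b3).

(** The sections of M and of O^3 by [ell] are both realised as the vectors of sum 0 with all entries
    congruent modulo 7, through [ofM] and through [ofY]. *)
Lemma num7_flat m :
  num7 (14 * m) (fun x => affine7 x && flat7 x) = num6 m ell.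
Proof.
have sphere_Y y : sphere7 (14 * m) (ofY y) = (hnorm y == m).
  case: y => [[[[[a1 b1] a2] b2] a3] b3]; rewrite /ofY /sphere7 !eq_op_Z.
  set s := (X in X =? 0); have -> : s = 0 by rewrite /s; ring.
  set n := (X in X =? 14 * m).
  have -> : n = 14 * hnorm (a1, b1, a2, b2, a3, b3) by rewrite /n /=; ring.
  by move: (hnorm _) => N; apply/Z.eqb_spec/Z.eqb_spec; lia.
symmetry; rewrite /num6 /num7; apply: (eq_count_rel (r := fun y x => x = ofY y));
  rewrite ?box6_uniq ?box7_uniq //.
- by move=> y /andP[/eqP/mem_box6].
- by move=> x /andP[/mem_box7].
- move=> y /andP[Qy ly]; exists (ofY y); rewrite // sphere_Y Qy /=.
  move: y ly {Qy} => [[[[[a1 b1] a2] b2] a3] b3] /eqP/mod_exists[//|d hd].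
  apply/andP; split; last by apply: (@eq0_mod 7 (- b2)); lia.
  by apply: (@affine7W _ _ _ _ _ _ _ (- 7 * b2)
   (2 * d - (a2 + 4 * b2) - (a3 + 4 * b3) + 3 * b2 - b1)
   (2 * d - (a2 + 4 * b2) - (a3 + 4 * b3) + 4 * b2 - b1 - b3)
   (3 * d - (a2 + 4 * b2) - 2 * (a3 + 4 * b3) + b3 - b1 + 4 * b2)
   (3 * d - (a2 + 4 * b2) - 2 * (a3 + 4 * b3) + b3 - 2 * b1 + 5 * b2)
   (4 * d - (a2 + 4 * b2) - 2 * (a3 + 4 * b3) - 2 * b1 + 5 * b2 - b3)); lia.
- move=> [[[[[[x0 x1] x2] x3] x4] x5] x6] /andP[sx] /andP[/affine7P].
  move=> [u [k2 [k3 [k4 [k5 [k6 [e1 [e2 [e3 [e4 [e5 e6]]]]]]]]]]].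
  case/eqP/mod_exists=> // v hv.
  (* With [v], these are the quotients (x_i - x_0) / 7; the preimage under [ofY] is linear in
     them. *)
  pose l2 := 2 * v + k2; pose l3 := 3 * v + k3; pose l4 := 4 * v + k4.
  pose l5 := 5 * v + k5; pose l6 := 6 * v + k6.
  have /andP[/eqP s0 _] := sx.
  pose y := (- v + l5 + l6, l4 - l5, v - l2 - l3 + l6, - v, l3 - l4 - l5 + l6, l2 - l3).
  have yE : ofY y = (x0, x1, x2, x3, x4, x5, x6).
    by rewrite /ofY /y /l2 /l3 /l4 /l5 /l6; do 6?[apply: (congr2 pair)]; lia.
  exists y => //; rewrite -sphere_Y yE sx /y /=.
  by apply: (@eq0_mod 7 (- v + 2 * l2 - 2 * l3 - l5 + l6)); ring.
- by move=> y x x' -> ->.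
move=> [[[[[a1 b1] a2] b2] a3] b3] [[[[[c1 d1] c2] d2] c3] d3] x -> [].
by move=> *; do 5?[apply: (congr2 pair)]; lia.
Qed.

Definition res7 : seq Z := [:: 0; 1; 2; 3; 4; 5; 6].

Lemma all_res7 (p : Z -> Z -> Z -> bool) :
    all (fun r1 => all (fun r2 => all (p r1 r2) res7) res7) res7 ->
  forall a b c, p (a mod 7) (b mod 7) (c mod 7).
Proof.
have mem_res a : a mod 7 \in res7.
  by have := Z.mod_pos_bound a 7 erefl; rewrite /res7 !inE; lia.
move=> p_ok a b c.
by have /allP/(_ _ (mem_res a))/allP/(_ _ (mem_res b))/allP/(_ _ (mem_res c)) := p_ok.
Qed.

Lemma lin3_mod7 k1 k2 k3 a b c : (k1 * a + k2 * b + k3 * c) mod 7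
  = (k1 * (a mod 7) + k2 * (b mod 7) + k3 * (c mod 7)) mod 7.
Proof.
rewrite -(Z_mod_plus_full (_ + k3 * (c mod 7)) (k1 * (a / 7) + k2 * (b / 7) + k3 * (c / 7))).
congr (_ mod _); rewrite {1}(Z.div_mod a 7) // {1}(Z.div_mod b 7) //.
by rewrite {1}(Z.div_mod c 7) //; ring.
Qed.

(** Modulo 7, a^2 + a b + 2 b^2 is (a + 4 b)^2. *)
Lemma hnorm_mod7 a1 b1 a2 b2 a3 b3
    (r1 := (a1 + 4 * b1) mod 7) (r2 := (a2 + 4 * b2) mod 7)
    (r3 := (a3 + 4 * b3) mod 7) :
  hnorm (a1, b1, a2, b2, a3, b3) mod 7 = (r1 * r1 + r2 * r2 + r3 * r3) mod 7.
Proof.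
rewrite -(Z_mod_plus_full (hnorm _) (a1 * b1 + 2 * b1 * b1
  + a2 * b2 + 2 * b2 * b2 + a3 * b3 + 2 * b3 * b3)).
rewrite -(Z_mod_plus_full (r1 * r1 + _ + _)
   (((a1 + 4 * b1) / 7) * (a1 + 4 * b1 + r1) + ((a2 + 4 * b2) / 7) * (a2 + 4 * b2 + r2)
     + ((a3 + 4 * b3) / 7) * (a3 + 4 * b3 + r3))).
have h a : a mod 7 = a - 7 * (a / 7) by have := Z.div_mod a 7; lia.
by congr (_ mod _); rewrite /r1 /r2 /r3 !h /=; ring.
Qed.

Definition flip1 (y : vec6) : vec6 :=
  let: (a1, b1, a2, b2, a3, b3) := y in (- a1, - b1, a2, b2, a3, b3).

Definition flip2 (y : vec6) : vec6 :=
  let: (a1, b1, a2, b2, a3, b3) := y in (a1, b1, - a2, - b2, a3, b3).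

Definition flip3 (y : vec6) : vec6 :=
  let: (a1, b1, a2, b2, a3, b3) := y in (a1, b1, a2, b2, - a3, - b3).

Definition swap23 (y : vec6) : vec6 :=
  let: (a1, b1, a2, b2, a3, b3) := y in (a1, b1, a3, b3, a2, b2).

Lemma flip1K : involutive flip1.
Proof. by case=> [[[[[? ?] ?] ?] ?] ?]; rewrite /= !Z.opp_involutive. Qed.

Lemma flip2K : involutive flip2.
Proof. by case=> [[[[[? ?] ?] ?] ?] ?]; rewrite /= !Z.opp_involutive. Qed.

Lemma flip3K : involutive flip3.
Proof. by case=> [[[[[? ?] ?] ?] ?] ?]; rewrite /= !Z.opp_involutive. Qed.

Lemma swap23K : involutive swap23.
Proof. by case=> [[[[[? ?] ?] ?] ?] ?]. Qed.

Lemma num6_flip1 q (P : pred vec6) : num6 q (fun y => P (flip1 y)) = num6 q P.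
Proof.
apply: (num6_reindex _ _ flip1K flip1K).
by case=> [[[[[? ?] ?] ?] ?] ?] /=; ring.
Qed.

Lemma num6_flip2 q (P : pred vec6) : num6 q (fun y => P (flip2 y)) = num6 q P.
Proof.
apply: (num6_reindex _ _ flip2K flip2K).
by case=> [[[[[? ?] ?] ?] ?] ?] /=; ring.
Qed.

Lemma num6_flip3 q (P : pred vec6) : num6 q (fun y => P (flip3 y)) = num6 q P.
Proof.
apply: (num6_reindex _ _ flip3K flip3K).
by case=> [[[[[? ?] ?] ?] ?] ?] /=; ring.
Qed.

Lemma num6_swap23 q (P : pred vec6) : num6 q (fun y => P (swap23 y)) = num6 q P.
Proof.
apply: (num6_reindex _ _ swap23K swap23K).
by case=> [[[[[? ?] ?] ?] ?] ?] /=; ring.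
Qed.

Definition lin7z (k1 k2 k3 r1 r2 r3 : Z) : bool :=
  (k1 * r1 + k2 * r2 + k3 * r3) mod 7 == 0.

Lemma ellformE k1 k2 k3 a1 b1 a2 b2 a3 b3 :
  ellform k1 k2 k3 (a1, b1, a2, b2, a3, b3) =
  lin7z k1 k2 k3 ((a1 + 4 * b1) mod 7) ((a2 + 4 * b2) mod 7) ((a3 + 4 * b3) mod 7).
Proof. by rewrite /ellform lin3_mod7. Qed.

Lemma ellform_flip1 k1 k2 k3 y :
  ellform k1 k2 k3 (flip1 y) = ellform (- k1) k2 k3 y.
Proof.
case: y => [[[[[a1 b1] a2] b2] a3] b3]; rewrite /ellform /=.
by congr (_ mod _ == _); ring.
Qed.

Lemma ellform_flip2 k1 k2 k3 y :
  ellform k1 k2 k3 (flip2 y) = ellform k1 (- k2) k3 y.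
Proof.
case: y => [[[[[a1 b1] a2] b2] a3] b3]; rewrite /ellform /=.
by congr (_ mod _ == _); ring.
Qed.

Lemma ellform_flip3 k1 k2 k3 y :
  ellform k1 k2 k3 (flip3 y) = ellform k1 k2 (- k3) y.
Proof.
case: y => [[[[[a1 b1] a2] b2] a3] b3]; rewrite /ellform /=.
by congr (_ mod _ == _); ring.
Qed.

Lemma ellform_swap23 k1 k2 k3 y :
  ellform k1 k2 k3 (swap23 y) = ellform k1 k3 k2 y.
Proof.
case: y => [[[[[a1 b1] a2] b2] a3] b3]; rewrite /ellform /=.
by congr (_ mod _ == _); ring.
Qed.

Definition num_ell q (P : pred vec6) (k1 k2 k3 : Z) : nat :=
  num6 q (fun y => ellform k1 k2 k3 y && P y).

(** The eight forms below are isotropic, as 1 + 4 + 16 = 21, and the symmetries of [P] give them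
    equal counts. Each vector lies on two of the hyperplanes, so twice the total is eight times the
    count for [ell]. *)
Lemma num6_nonresidue q (P : pred vec6) :
    q mod 7 \in [:: 3; 5; 6] ->
    (forall y, P (flip1 y) = P y) -> (forall y, P (flip2 y) = P y) ->
    (forall y, P (swap23 y) = P y) ->
  num6 q P = (4 * num6 q (fun y => ell y && P y))%N.
Proof.
move=> q_nres P_flip1 P_flip2 P_swap.
pose n := num_ell q P.
have n_flip1 k1 k2 k3 : n (- k1) k2 k3 = n k1 k2 k3.
  rewrite /n /num_ell -num6_flip1; apply: eq_in_num6 => y _.
  by rewrite ellform_flip1 P_flip1 Z.opp_involutive.
have n_flip2 k1 k2 k3 : n k1 (- k2) k3 = n k1 k2 k3.
  rewrite /n /num_ell -num6_flip2; apply: eq_in_num6 => y _.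
  by rewrite ellform_flip2 P_flip2 Z.opp_involutive.
have n_swap k1 k2 k3 : n k1 k3 k2 = n k1 k2 k3.
  rewrite /n /num_ell -num6_swap23; apply: eq_in_num6 => y _.
  by rewrite ellform_swap23 P_swap.
suff : (2 * num6 q P = num_ell q P 1 2 4 + num_ell q P (- 1) 2 4 + num_ell q P 1 (- 2) 4 + num_ell q P (- 1) (- 2) 4
    + (num_ell q P 1 4 2 + num_ell q P (- 1) 4 2 + num_ell q P 1 4 (- 2) + num_ell q P (- 1) 4 (- 2)))%N.
  rewrite -/n (n_swap 1 (- 2) 4) (n_swap (- 1) (- 2) 4) (n_swap (- 1) 2 4).
  rewrite (n_swap 1 2 4) (n_flip1 1 (- 2) 4) (n_flip2 1 2 4) (n_flip1 1 2 4).
  by rewrite /n /num_ell; lia.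
rewrite /num_ell !num6E !big_distrr -!big_split /=; apply: eq_bigr => y /eqP Qy.
move: q_nres; rewrite -Qy.
case: y {Qy} => [[[[[a1 b1] a2] b2] a3] b3]; rewrite hnorm_mod7 !ellformE.
case: (P _); rewrite ?andbF ?andbT // => q_nres; apply/eqP; apply/implyP: q_nres.
(* The two hyperplanes through a vector of nonresidue norm, counted over all residue triples. *)
apply: (@all_res7 (fun r1 r2 r3 =>
  ((r1 * r1 + r2 * r2 + r3 * r3) mod 7 \in [:: 3; 5; 6]) ==>
  (2 * true == lin7z 1 2 4 r1 r2 r3 + lin7z (- 1) 2 4 r1 r2 r3 + lin7z 1 (- 2) 4 r1 r2 r3
    + lin7z (- 1) (- 2) 4 r1 r2 r3 + (lin7z 1 4 2 r1 r2 r3 + lin7z (- 1) 4 2 r1 r2 r3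
    + lin7z 1 4 (- 2) r1 r2 r3 + lin7z (- 1) 4 (- 2) r1 r2 r3))%N)).
by vm_compute.
Qed.

Lemma latM_flip1 y : latM (flip1 y) = latM y.
Proof.
case: y => [[[[[a1 b1] a2] b2] a3] b3]; rewrite /latM /= !eq0_mod2.
by rewrite !Z.odd_sub !Z.odd_add !Z.odd_opp.
Qed.

Lemma latM_flip2 y : latM (flip2 y) = latM y.
Proof.
case: y => [[[[[a1 b1] a2] b2] a3] b3]; rewrite /latM /= !eq0_mod2.
by rewrite !Z.odd_sub !Z.odd_add !Z.odd_opp.
Qed.

Lemma latM_flip3 y : latM (flip3 y) = latM y.
Proof.
case: y => [[[[[a1 b1] a2] b2] a3] b3]; rewrite /latM /= !eq0_mod2.
by rewrite !Z.odd_sub !Z.odd_add !Z.odd_opp.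
Qed.

Lemma latM_swap23 y : latM (swap23 y) = latM y.
Proof.
case: y => [[[[[a1 b1] a2] b2] a3] b3]; rewrite /latM /= !eq0_mod2.
rewrite !Z.odd_sub !Z.odd_add.
by case: (Z.odd a1) (Z.odd b1) (Z.odd a2) (Z.odd b2) (Z.odd a3) (Z.odd b3)
    => [] [] [] [] [] [].
Qed.

(** In both lattices three quarters of the vectors lie off the hyperplane, and the sections agree by
    [num7_flat]. In M the norm is 2 m, again a nonresidue because 2 is a square modulo 7. *)
Lemma num7_slanted_nonresidue m : m mod 7 \in [:: 3; 5; 6] ->
  num7 (14 * m) slanted = num6 m (fun y => ~~ ell y).
Proof.
move=> m_nres.
have split_ell q (P : pred vec6) :
    (num6 q (fun y => ell y && P y) + num6 q (fun y => ~~ ell y && P y) = num6 q P)%N.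
  by rewrite !num6E -big_split /=; apply: eq_bigr => y _; case: (ell y); case: (P y).
have O_eq := num6_nonresidue (P := predT) m_nres (fun=> erefl) (fun=> erefl) (fun=> erefl).
have m2_nres : (2 * m) mod 7 \in [:: 3; 5; 6].
  rewrite Z.mul_mod //; move: m_nres; rewrite !inE.
  by case/or3P=> /eqP->.
have M_eq := num6_nonresidue m2_nres latM_flip1 latM_flip2 latM_swap23.
have := split_ell m predT; have := split_ell (2 * m) latM.
have -> : num7 (14 * m) slanted = num6 (2 * m) (fun y => ~~ ell y && latM y).
  under eq_in_num7 => x _ do rewrite -[slanted x]andbT.
  rewrite (num7_ofM_slanted m (fun=> true)).
  by apply: eq_in_num6 => y _; rewrite andbT.
have -> : num6 (2 * m) (fun y => ell y && latM y) = num6 m ell.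
  rewrite -num7_flat num7_ofM; apply: eq_in_num6 => y _.
  by case My: (latM y); rewrite ?andbF // andbT ofM_slope.
have <- : num6 m (fun y => ell y && predT y) = num6 m ell.
  by apply: eq_in_num6 => y _; rewrite andbT.
have <- : num6 m (fun y => ~~ ell y && predT y) = num6 m (fun y => ~~ ell y).
  by apply: eq_in_num6 => y _; rewrite andbT.
rewrite M_eq O_eq.
have -> : num6 (2 * m) (fun y => ell y && latM y) = num6 m ell.
  rewrite -num7_flat num7_ofM; apply: eq_in_num6 => y _.
  by case My: (latM y); rewrite ?andbF // andbT ofM_slope.
have -> : num6 m (fun y => ell y && predT y) = num6 m ell.
  by apply: eq_in_num6 => y _; rewrite andbT.
lia.
Qed.

(** * Vectors with two or six odd entries *)

Definition odd_bits (x : vec7) : seq bool :=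
  let: (x0, x1, x2, x3, x4, x5, x6) := x in
  [:: Z.odd x0; Z.odd x1; Z.odd x2; Z.odd x3; Z.odd x4; Z.odd x5; Z.odd x6].

Definition odd_but0 : seq bool := [:: false; true; true; true; true; true; true].

Definition odd_only (i j : nat) : seq bool := [seq (k == i) || (k == j) | k <- iota 0 7].

Lemma num7_nodd6 m :
  num7 (14 * m) (fun x => slanted x && (nodd7 x == 6%N))
  = (7 * num7 (14 * m) (fun x => slanted x && (odd_bits x == odd_but0)))%N.
Proof.
pose n j := num7 (14 * m) (fun x => slanted x && (odd_bits (iter j shift7 x) == odd_but0)).
have n0 j : n j = n 0%N.
  elim: j => // j <-; rewrite /n.
  rewrite -[RHS](num7_shift7 _ (fun x => odd_bits (iter j shift7 x) == odd_but0)).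
  by apply: eq_in_num7 => x _; rewrite -iterSr.
have -> : (7 * num7 (14 * m) (fun x => slanted x && (odd_bits x == odd_but0))
    = n 0 + n 1 + n 2 + n 3 + n 4 + n 5 + n 6)%N.
  by rewrite (n0 1%N) (n0 2%N) (n0 3%N) (n0 4%N) (n0 5%N) (n0 6%N) /n /=; lia.
rewrite /n !num7E -!big_split /=; apply: eq_bigr => x _; case: (slanted x) => //.
case: x => [[[[[[x0 x1] x2] x3] x4] x5] x6] /=.
by case: (Z.odd x0) (Z.odd x1) (Z.odd x2) (Z.odd x3) (Z.odd x4) (Z.odd x5)
         (Z.odd x6) => [] [] [] [] [] [] [].
Qed.

(** The 21 pairs of indices form one orbit: [mul7] permutes the three differences up to sign and
    [shift7] translates. The pair 1, 5 is the one that [flip1] relates to [odd_but0]. *)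
Lemma num7_nodd2 m :
  num7 (14 * m) (fun x => slanted x && (nodd7 x == 2%N))
  = (21 * num7 (14 * m) (fun x => slanted x && (odd_bits x == odd_only 1 5)))%N.
Proof.
pose n i j := num7 (14 * m)
  (fun x => slanted x && (odd_bits (iter i mul7 (iter j shift7 x)) == odd_only 1 5)).
have n0 i j : n i j = n i 0%N.
  elim: j => // j <-; rewrite /n.
  rewrite -[RHS](num7_shift7 _
    (fun x => odd_bits (iter i mul7 (iter j shift7 x)) == odd_only 1 5)).
  by apply: eq_in_num7 => x _; rewrite -iterSr.
have n00 i : n i 0%N = n 0%N 0%N.
  elim: i => // i <-; rewrite /n.
  rewrite -[RHS](num7_mul7 _ (fun x => odd_bits (iter i mul7 x) == odd_only 1 5)).
  by apply: eq_in_num7 => x _ /=; rewrite -iterSr.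
have -> : (21 * num7 (14 * m) (fun x => slanted x && (odd_bits x == odd_only 1 5))
    = (n 0 0 + n 0 1 + n 0 2 + n 0 3 + n 0 4 + n 0 5 + n 0 6)
    + (n 1 0 + n 1 1 + n 1 2 + n 1 3 + n 1 4 + n 1 5 + n 1 6)
    + (n 2 0 + n 2 1 + n 2 2 + n 2 3 + n 2 4 + n 2 5 + n 2 6))%N.
  rewrite !(n0 _ 1%N) !(n0 _ 2%N) !(n0 _ 3%N) !(n0 _ 4%N) !(n0 _ 5%N) !(n0 _ 6%N).
  by rewrite (n00 1%N) (n00 2%N) /n /=; lia.
rewrite /n !num7E -!big_split /=; apply: eq_bigr => x _; case: (slanted x) => //.
case: x => [[[[[[x0 x1] x2] x3] x4] x5] x6] /=.
by case: (Z.odd x0) (Z.odd x1) (Z.odd x2) (Z.odd x3) (Z.odd x4) (Z.odd x5)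
         (Z.odd x6) => [] [] [] [] [] [] [].
Qed.

(** The inverse of [ofM] modulo 2. With it, the effect of sign changes and swaps on the parities of
    x becomes a finite check. *)
Lemma parity_ofM a1 b1 a2 b2 a3 b3 (y := (a1, b1, a2, b2, a3, b3)) x :
    latM y -> ofM_rel y x ->
  let: (x0, x1, x2, x3, x4, x5, x6) := x in
  [/\ Z.odd a1 = Z.odd (x1 + x2 + x4), Z.odd a2 = Z.odd a1, Z.odd a3 = Z.odd a1
    & [/\ Z.odd b1 = Z.odd (x0 + x1 + x5) (+) Z.odd a1,
          Z.odd b3 = Z.odd (x0 + x2 + x3) (+) Z.odd a1,
          Z.odd b2 = Z.odd a1 (+) Z.odd b1 (+) Z.odd b3
        & Z.odd (x0 + x1 + x2 + x3 + x4 + x5 + x6) = false]].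
Proof.
rewrite /y; case: x => [[[[[[x0 x1] x2] x3] x4] x5] x6] My.
move=> /= [h0 [h1 [h2 [h3 [h4 [h5 h6]]]]]].
rewrite (_ : x1 + x2 + x4 = 2 * (a1 + a2 + a3) + (b1 + b2 + b3)); last by lia.
rewrite (_ : _ + x6 = 2 * 0); last by lia.
rewrite (_ : x0 + x2 + x3 = 2 * (2 * b1 - a3) + a1 - b3); last by lia.
rewrite (_ : x0 + x1 + x5 = 2 * (- a1 + 2 * b2) + a2 - b1); last by lia.
move: My; rewrite /latM !eq0_mod2 !Z.odd_sub !Z.odd_add !Zodd_double.
by case: (Z.odd a1) (Z.odd b1) (Z.odd a2) (Z.odd b2) (Z.odd a3) (Z.odd b3)
    => [] [] [] [] [] [].
Qed.

(** A sign change permutes the classes of M modulo 2 but moves the hyperplane [ell]; so two odd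
    entries can be traded for six odd entries off another hyperplane. *)
Lemma odd_bits_flip1 y : latM y ->
  (odd_bits (ofM (flip1 y)) == odd_but0) = (odd_bits (ofM y) == odd_only 1 5).
Proof.
move=> My; have Mfy : latM (flip1 y) by rewrite latM_flip1.
have /(_ erefl) h := (ofM_relP (ofM y) My).2.
have /(_ erefl) h' := (ofM_relP (ofM (flip1 y)) Mfy).2.
move: (ofM y) (ofM (flip1 y)) h h' => x x' h h'.
case: y My {Mfy} h h' => [[[[[a1 b1] a2] b2] a3] b3] My h.
have := parity_ofM My h; move: h.
case: x => [[[[[[x0 x1] x2] x3] x4] x5] x6] /= [h0 [h1 [h2 [h3 [h4 [h5 h6]]]]]].
move=> [e1 _ _ [e2 _ _ e3]].
case: x' => [[[[[[z0 z1] z2] z3] z4] z5] z6] /= [g0 [g1 [g2 [g3 [g4 [g5 g6]]]]]].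
(* Each change is an integral form in a_1, b_1, written as its reduction modulo 2 plus an even
   part. *)
rewrite (_ : z0 = x0 + a1 + b1 + 2 * (0 * a1 + -2 * b1)); last by clear -h0 g0; lia.
rewrite (_ : z1 = x1 + 2 * (0 * a1 + 0 * b1)); last by clear -h1 g1; lia.
rewrite (_ : z2 = x2 + a1 + 2 * (-1 * a1 + -2 * b1)); last by clear -h2 g2; lia.
rewrite (_ : z3 = x3 + b1 + 2 * (-1 * a1 + -1 * b1)); last by clear -h3 g3; lia.
rewrite (_ : z4 = x4 + a1 + 2 * (-2 * a1 + 1 * b1)); last by clear -h4 g4; lia.
rewrite (_ : z5 = x5 + a1 + b1 + 2 * (1 * a1 + 2 * b1)); last by clear -h5 g5; lia.
rewrite (_ : z6 = x6 + b1 + 2 * (1 * a1 + 0 * b1)); last by clear -h6 g6; lia.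
rewrite !Z.odd_add !Zodd_double e2 e1; move: e3; rewrite !Z.odd_add.
by case: (Z.odd x0) (Z.odd x1) (Z.odd x2) (Z.odd x3) (Z.odd x4) (Z.odd x5)
         (Z.odd x6) => [] [] [] [] [] [] [].
Qed.

Lemma odd_bits_flip2 y : latM y ->
  (odd_bits (ofM (flip2 y)) == odd_but0) = (odd_bits (ofM y) == odd_only 4 6).
Proof.
move=> My; have Mfy : latM (flip2 y) by rewrite latM_flip2.
have /(_ erefl) h := (ofM_relP (ofM y) My).2.
have /(_ erefl) h' := (ofM_relP (ofM (flip2 y)) Mfy).2.
move: (ofM y) (ofM (flip2 y)) h h' => x x' h h'.
case: y My {Mfy} h h' => [[[[[a1 b1] a2] b2] a3] b3] My h.
have := parity_ofM My h; move: h.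
case: x => [[[[[[x0 x1] x2] x3] x4] x5] x6] /= [h0 [h1 [h2 [h3 [h4 [h5 h6]]]]]].
move=> [e1 e2 _ [e4 e5 e6 e3]].
case: x' => [[[[[[z0 z1] z2] z3] z4] z5] z6] /= [g0 [g1 [g2 [g3 [g4 [g5 g6]]]]]].
rewrite (_ : z0 = x0 + a2 + b2 + 2 * (0 * a2 + -2 * b2)); last by clear -h0 g0; lia.
rewrite (_ : z1 = x1 + a2 + 2 * (-1 * a2 + -2 * b2)); last by clear -h1 g1; lia.
rewrite (_ : z2 = x2 + a2 + 2 * (-2 * a2 + 1 * b2)); last by clear -h2 g2; lia.
rewrite (_ : z3 = x3 + b2 + 2 * (1 * a2 + 0 * b2)); last by clear -h3 g3; lia.
rewrite (_ : z4 = x4 + 2 * (0 * a2 + 0 * b2)); last by clear -h4 g4; lia.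
rewrite (_ : z5 = x5 + b2 + 2 * (-1 * a2 + -1 * b2)); last by clear -h5 g5; lia.
rewrite (_ : z6 = x6 + a2 + b2 + 2 * (1 * a2 + 2 * b2)); last by clear -h6 g6; lia.
rewrite !Z.odd_add !Zodd_double e2 e6 e4 e5 e1; move: e3; rewrite !Z.odd_add.
by case: (Z.odd x0) (Z.odd x1) (Z.odd x2) (Z.odd x3) (Z.odd x4) (Z.odd x5)
         (Z.odd x6) => [] [] [] [] [] [] [].
Qed.

Lemma odd_bits_flip3 y : latM y ->
  (odd_bits (ofM (flip3 y)) == odd_but0) = (odd_bits (ofM y) == odd_only 2 3).
Proof.
move=> My; have Mfy : latM (flip3 y) by rewrite latM_flip3.
have /(_ erefl) h := (ofM_relP (ofM y) My).2.
have /(_ erefl) h' := (ofM_relP (ofM (flip3 y)) Mfy).2.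
move: (ofM y) (ofM (flip3 y)) h h' => x x' h h'.
case: y My {Mfy} h h' => [[[[[a1 b1] a2] b2] a3] b3] My h.
have := parity_ofM My h; move: h.
case: x => [[[[[[x0 x1] x2] x3] x4] x5] x6] /= [h0 [h1 [h2 [h3 [h4 [h5 h6]]]]]].
move=> [e1 _ e2 [_ e4 _ e3]].
case: x' => [[[[[[z0 z1] z2] z3] z4] z5] z6] /= [g0 [g1 [g2 [g3 [g4 [g5 g6]]]]]].
rewrite (_ : z0 = x0 + a3 + b3 + 2 * (0 * a3 + -2 * b3)); last by clear -h0 g0; lia.
rewrite (_ : z1 = x1 + a3 + 2 * (-2 * a3 + 1 * b3)); last by clear -h1 g1; lia.
rewrite (_ : z2 = x2 + 2 * (0 * a3 + 0 * b3)); last by clear -h2 g2; lia.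
rewrite (_ : z3 = x3 + a3 + b3 + 2 * (1 * a3 + 2 * b3)); last by clear -h3 g3; lia.
rewrite (_ : z4 = x4 + a3 + 2 * (-1 * a3 + -2 * b3)); last by clear -h4 g4; lia.
rewrite (_ : z5 = x5 + b3 + 2 * (1 * a3 + 0 * b3)); last by clear -h5 g5; lia.
rewrite (_ : z6 = x6 + b3 + 2 * (-1 * a3 + -1 * b3)); last by clear -h6 g6; lia.
rewrite !Z.odd_add !Zodd_double e2 e4 e1; move: e3; rewrite !Z.odd_add.
by case: (Z.odd x0) (Z.odd x1) (Z.odd x2) (Z.odd x3) (Z.odd x4) (Z.odd x5)
         (Z.odd x6) => [] [] [] [] [] [] [].
Qed.


Lemma odd_bits_swap23 y : latM y ->
  (odd_bits (ofM (swap23 y)) == odd_but0) = (odd_bits (ofM y) == odd_but0).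
Proof.
move=> My; have Msy : latM (swap23 y) by rewrite latM_swap23.
have /(_ erefl) h := (ofM_relP (ofM y) My).2.
have /(_ erefl) h' := (ofM_relP (ofM (swap23 y)) Msy).2.
move: (ofM y) (ofM (swap23 y)) h h' => x x' h h'.
case: y My {Msy} h h' => [[[[[a1 b1] a2] b2] a3] b3] My h.
have := parity_ofM My h; move: h.
case: x => [[[[[[x0 x1] x2] x3] x4] x5] x6] /= [h0 [h1 [h2 [h3 [h4 [h5 h6]]]]]].
move=> [e1 e2 a31 [f1 f3 f2 e3]].
(* Half of a_3 - a_2 enters the change of x, so its parity must be expressed through x as well. *)
have [t ht] : exists t, a3 = a2 + 2 * t by apply: odd_eqP; rewrite e2 a31.
case: x' => [[[[[[z0 z1] z2] z3] z4] z5] z6] /= [g0 [g1 [g2 [g3 [g4 [g5 g6]]]]]].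
have et : Z.odd t = Z.odd (x1 + x2 + x5 + x6).
  rewrite (_ : _ + x6 = 2 * (- a1 - b1 - b2 - b3 + a2 + t) + b1 + b2 + b3 + a2 + t); last by clear -h1 h2 h5 h6 ht; lia.
  rewrite !Z.odd_add Zodd_double e2 f2.
  by case: (Z.odd a1) (Z.odd b1) (Z.odd b3) (Z.odd t) => [] [] [] [].
rewrite (_ : z0 = x0); last by clear -h0 g0 ht; lia.
rewrite (_ : z1 = x1 + b2 + b3 + 2 * (- t + b3 - 2 * b2)); last by clear -h1 g1 ht; lia.
rewrite (_ : z2 = x2 + t + b2 + b3 + 2 * (t - b3)); last by clear -h2 g2 ht; lia.
rewrite (_ : z3 = x3 + t + 2 * (b3 - b2)); last by clear -h3 g3 ht; lia.
rewrite (_ : z4 = x4 + t + 2 * (- t - b3 + b2)); last by clear -h4 g4 ht; lia.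
rewrite (_ : z5 = x5 + b2 + b3 + 2 * (2 * t - b2)); last by clear -h5 g5 ht; lia.
rewrite (_ : z6 = x6 + t + b2 + b3 + 2 * (- 3 * t - 2 * b3 + b2)); last by clear -h6 g6 ht; lia.
rewrite !Z.odd_add !Zodd_double et f2 f1 f3 e1; move: e3; rewrite !Z.odd_add.
by case: (Z.odd x0) (Z.odd x1) (Z.odd x2) (Z.odd x3) (Z.odd x4) (Z.odd x5)
         (Z.odd x6) => [] [] [] [] [] [] [].
Qed.

Lemma num7_odd_only m i j (f : vec6 -> vec6) (k1 k2 k3 : Z) :
    (forall y, latM y -> (odd_bits (ofM (f y)) == odd_but0) = (odd_bits (ofM y) == odd_only i j)) ->
    (forall y, latM (f y) = latM y) -> (forall y, ell y = ellform k1 k2 k3 (f y)) ->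
    (forall P, num6 (2 * m) (fun y => P (f y)) = num6 (2 * m) P) ->
  num7 (14 * m) (fun x => slanted x && (odd_bits x == odd_only i j))
    = num6 (2 * m) (fun y => ~~ ellform k1 k2 k3 y
        && (latM y && (odd_bits (ofM y) == odd_but0))).
Proof.
move=> bits_f latM_f ell_f num_f; rewrite num7_ofM_slanted.
rewrite -[RHS]num_f; apply: eq_in_num6 => y _; rewrite -ell_f latM_f.
by case My: (latM y); rewrite // bits_f.
Qed.

Lemma num7_nodd2_ge m :
  (2 * num7 (14 * m) (fun x => slanted x && (nodd7 x == 6%N))
    <= num7 (14 * m) (fun x => slanted x && (nodd7 x == 2%N)))%N.
Proof.
rewrite num7_nodd6 num7_nodd2.
pose T y := latM y && (odd_bits (ofM y) == odd_but0).
pose n i j := num7 (14 * m) (fun x => slanted x && (odd_bits x == odd_only i j)).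
(* Doubling the index permutes the pairs {1, 5}, {2, 3}, {4, 6} attached to the three sign
   changes. *)
have n_mul i j i' j' : (forall x, (odd_bits (mul7 (mul7 x)) == odd_only i j)
    = (odd_bits x == odd_only i' j')) -> n i' j' = n i j.
  move=> mulE; rewrite /n -[RHS](num7_mul7 _ (fun x => odd_bits x == odd_only i j)).
  rewrite -[RHS](num7_mul7 _ (fun x => odd_bits (mul7 x) == odd_only i j)).
  by apply: eq_in_num7 => x _; rewrite mulE.
have n23 : n 2%N 3%N = n 1%N 5%N.
  apply: n_mul => -[[[[[[x0 x1] x2] x3] x4] x5] x6] /=.
  by case: (Z.odd x0) (Z.odd x1) (Z.odd x2) (Z.odd x3) (Z.odd x4) (Z.odd x5)
         (Z.odd x6) => [] [] [] [] [] [] [].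
have n46 : n 4%N 6%N = n 1%N 5%N.
  rewrite -n23; apply: n_mul => -[[[[[[x0 x1] x2] x3] x4] x5] x6] /=.
  by case: (Z.odd x0) (Z.odd x1) (Z.odd x2) (Z.odd x3) (Z.odd x4) (Z.odd x5)
         (Z.odd x6) => [] [] [] [] [] [] [].
have e1 := num7_odd_only (k1 := - 1) (k2 := 2) (k3 := 4) (m := m) odd_bits_flip1 latM_flip1.
have e2 := num7_odd_only (k1 := 1) (k2 := - 2) (k3 := 4) (m := m) odd_bits_flip2 latM_flip2.
have e3 := num7_odd_only (k1 := 1) (k2 := 2) (k3 := - 4) (m := m) odd_bits_flip3 latM_flip3.
have {e1} e1 := e1 (fun y => esym (ellform_flip1 (- 1) 2 4 y)) (num6_flip1 _).
have {e2} e2 := e2 (fun y => esym (ellform_flip2 1 (- 2) 4 y)) (num6_flip2 _).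
have {e3} e3 := e3 (fun y => esym (ellform_flip3 1 2 (- 4) y)) (num6_flip3 _).
have swapT (k1 k2 k3 : Z) : num6 (2 * m) (fun y => ~~ ellform k1 k3 k2 y && T y)
    = num6 (2 * m) (fun y => ~~ ellform k1 k2 k3 y && T y).
  rewrite -[RHS]num6_swap23; apply: eq_in_num6 => y _.
  rewrite ellform_swap23 /T latM_swap23.
  by case My: (latM y); rewrite // odd_bits_swap23.
pose c k1 k2 k3 := num6 (2 * m) (fun y => ~~ ellform k1 k2 k3 y && T y).
have {}e1 : c (- 1) 2 4 = n 1%N 5%N by rewrite /n e1.
have {}e2 : c 1 (- 2) 4 = n 1%N 5%N by rewrite -n46 /n e2.
have {}e3 : c 1 2 (- 4) = n 1%N 5%N by rewrite -n23 /n e3.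
have e4 : c (- 1) 4 2 = n 1%N 5%N by rewrite -e1 /c swapT.
have e5 : c 1 4 (- 2) = n 1%N 5%N by rewrite -e2 /c swapT.
have e6 : c 1 (- 4) 2 = n 1%N 5%N by rewrite -e3 /c swapT.
(* A vector off [ell] is off at least four of six other isotropic hyperplanes, each with the same
   count. The bound 4 E <= 6 N gives 2 * 7 E <= 21 N. *)
have : (4 * num6 (2 * m) (fun y => ~~ ell y && T y) <= 6 * n 1 5)%N.
  have -> : (6 * n 1 5 = n 1 5 + n 1 5 + n 1 5 + n 1 5 + n 1 5 + n 1 5)%N by lia.
  rewrite -{1}e1 -{1}e2 -{1}e3 -{1}e4 -{1}e5 -{1}e6 /c.
  rewrite !num6E !big_distrr -!big_split /=; apply: leq_sum => y _.
  case: (T y); rewrite ?andbF // !andbT.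
  case: y => [[[[[a1 b1] a2] b2] a3] b3]; rewrite !ellformE.
  apply: (@all_res7 (fun r1 r2 r3 =>
    (4 * ~~ lin7z 1 2 4 r1 r2 r3 <= ~~ lin7z (- 1) 2 4 r1 r2 r3
      + ~~ lin7z 1 (- 2) 4 r1 r2 r3 + ~~ lin7z 1 2 (- 4) r1 r2 r3
      + ~~ lin7z (- 1) 4 2 r1 r2 r3 + ~~ lin7z 1 4 (- 2) r1 r2 r3
      + ~~ lin7z 1 (- 4) 2 r1 r2 r3)%N)).
  by vm_compute.
have -> : num6 (2 * m) (fun y => ~~ ell y && T y)
    = num7 (14 * m) (fun x => slanted x && (odd_bits x == odd_but0)).
  by rewrite num7_ofM_slanted.
rewrite -/(n 1%N 5%N); move: (num7 _ _) (n _ _) => E N; lia.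
Qed.

(** * From 7-cores to vectors *)

(** Slope 1 and x_0 = - 3 modulo 7: the residues of the vectors of 7-cores. *)
Definition std7 (x : vec7) : bool :=
  let: (x0, x1, x2, x3, x4, x5, x6) := x in
  [&& slanted x, (x1 - x0) mod 7 == 1 & x0 mod 7 == 4].

Lemma std7P x0 x1 x2 x3 x4 x5 x6 :
  reflect (exists v0 v1 v2 v3 v4 v5 v6,
      [/\ x0 = 7 * v0 - 3, x1 = 7 * v1 - 2, x2 = 7 * v2 - 1
        & [/\ x3 = 7 * v3, x4 = 7 * v4 + 1, x5 = 7 * v5 + 2 & x6 = 7 * v6 + 3]])
    (std7 (x0, x1, x2, x3, x4, x5, x6)).
Proof.
apply: (iffP idP) => [/and3P[/andP[/affine7P h _] /eqP u1 /eqP c4]|].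
  have [u [k2 [k3 [k4 [k5 [k6 [e1 [e2 [e3 [e4 [e5 e6]]]]]]]]]]] := h.
  have [l hl] : exists l, u = 7 * l + 1 by exists (u / 7); lia.
  have [c hc] : exists c, x0 = 7 * c - 3 by exists (x0 / 7 + 1); lia.
  clear h u1 c4; exists c, (c + l), (c + 2 * l + k2), (c + 3 * l + k3).
  exists (c + 4 * l + k4), (c + 5 * l + k5), (c + 6 * l + k6).
  by do 3?split; lia.
case=> v0 [v1 [v2 [v3 [v4 [v5 [v6 [-> -> -> [-> -> -> ->]]]]]]]].
have slope : (7 * v1 - 2 - (7 * v0 - 3)) mod 7 == 1.
  by rewrite (_ : _ - _ = 1 + (v1 - v0) * 7) ?Z_mod_plus_full //; ring.
apply/and3P; split=> //; last first.
  by rewrite (_ : _ - 3 = 4 + (v0 - 1) * 7) ?Z_mod_plus_full //; ring.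
apply/andP; split; last by rewrite /= (eqP slope).
by apply: (@affine7W _ _ _ _ _ _ _ (1 + 7 * (v1 - v0)) (v2 - 2 * v1 + v0)
  (v3 - 3 * v1 + 2 * v0) (v4 - 4 * v1 + 3 * v0) (v5 - 5 * v1 + 4 * v0)
  (v6 - 6 * v1 + 5 * v0)); lia.
Qed.

Lemma mulmod7 k u l a : a = k * u + 7 * l -> a mod 7 = (k * (u mod 7)) mod 7.
Proof.
move=> ->; rewrite -(Z_mod_plus_full (k * (u mod 7)) (k * (u / 7) + l)).
by congr (_ mod _); rewrite {1}(Z.div_mod u 7) //; ring.
Qed.

Lemma shiftmod7 k u c l a : a = c + k * u + 7 * l ->
  a mod 7 = (c mod 7 + k * (u mod 7)) mod 7.
Proof.
move=> ->; rewrite -(Z_mod_plus_full (c mod 7 + _) (c / 7 + k * (u / 7) + l)).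
congr (_ mod _); rewrite {1}(Z.div_mod u 7) // {1}(Z.div_mod c 7) //; ring.
Qed.

Definition hit7 (c k r e : Z) : bool := (c + k * r) mod 7 == e.

Definition slope7 (x : vec7) : Z :=
  let: (x0, x1, x2, x3, x4, x5, x6) := x in (x1 - x0) mod 7.

Definition head7 (x : vec7) : Z :=
  let: (x0, x1, x2, x3, x4, x5, x6) := x in x0 mod 7.

(** Among the 6 * 7 affine reindexings of a slanted vector exactly one is standard: a power of 3
    normalises the slope to 1, then a shift normalises x_0. *)
Lemma num7_std q (P : pred vec7) :
    (forall x, P (shift7 x) = P x) -> (forall x, P (mul7 x) = P x) ->
  num7 q (fun x => slanted x && P x) = (42 * num7 q (fun x => std7 x && P x))%N.
Proof.
move=> P_shift P_mul.
have P_shifts j x : P (iter j shift7 x) = P x by elim: j => //= j <-.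
have P_muls i x : P (iter i mul7 x) = P x by elim: i => //= i <-.
pose R x := (slope7 x == 1) && P x.
pose n i := num7 q (fun x => slanted x && R (iter i mul7 x)).
have n0 i : n i = n 0%N.
  elim: i => // i <-; rewrite /n -[RHS](num7_mul7 _ (fun x => R (iter i mul7 x))).
  by apply: eq_in_num7 => x _; rewrite -iterSr.
have slanted_n : (num7 q (fun x => slanted x && P x) = 6 * n 0)%N.
  have -> : (6 * n 0 = n 0 + n 1 + n 2 + n 3 + n 4 + n 5)%N.
    by rewrite (n0 1%N) (n0 2%N) (n0 3%N) (n0 4%N) (n0 5%N); lia.
  rewrite /n /R !num7E -!big_split /=; apply: eq_bigr => x _.
  rewrite !P_mul; case: (P x); rewrite ?andbF // !andbT.
  case sx: (slanted x) => //=; case: x sx => [[[[[[x0 x1] x2] x3] x4] x5] x6].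
  case/andP=> /affine7P[u [k2 [k3 [k4 [k5 [k6 [e1 [e2 [e3 [e4 [e5 e6]]]]]]]]]]].
  rewrite /slope7 /flat7 /=.
  rewrite (@mulmod7 1 u 0 (x1 - x0)) ?(@mulmod7 2 u k2 (x2 - x0)); [|lia..].
  rewrite (@mulmod7 3 u k3 (x3 - x0)) ?(@mulmod7 4 u k4 (x4 - x0)); [|lia..].
  rewrite (@mulmod7 5 u k5 (x5 - x0)) ?(@mulmod7 6 u k6 (x6 - x0)); [|lia..].
  move=> u_n0; apply/eqP; apply/implyP: u_n0.
  by apply: (@all_res7 (fun r _ _ => ~~ hit7 0 1 r 0 ==> (nat_of_bool true == (
    hit7 0 1 r 1 + hit7 0 3 r 1 + hit7 0 2 r 1 + hit7 0 6 r 1 + hit7 0 4 r 1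
    + hit7 0 5 r 1)%N)) _ u 0 0); vm_compute.
pose S x := (head7 x == 4) && P x.
pose n' j := num7 q (fun x => slanted x && ((slope7 x == 1) && S (iter j shift7 x))).
have n'0 j : n' j = n' 0%N.
  elim: j => // j <-; rewrite /n'.
  rewrite -[RHS](num7_shift7 _ (fun x => (slope7 x == 1) && S (iter j shift7 x))).
  apply: eq_in_num7 => x _; rewrite -iterSr.
  case sx: (slanted x) => //=; congr (_ && _).
  case: x sx => [[[[[[x0 x1] x2] x3] x4] x5] x6] /andP[/affine7P].
  move=> [u [k2 [_ [_ [_ [_ [e1 [e2 _]]]]]]]] _.
  rewrite /slope7 /= (@mulmod7 1 u 0 (x1 - x0)); last by lia.
  by rewrite (@mulmod7 1 u k2 (x2 - x1)) //; lia.
have std_n : num7 q (fun x => std7 x && P x) = n' 0%N.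
  apply: eq_in_num7 => -[[[[[[x0 x1] x2] x3] x4] x5] x6] _.
  by rewrite /std7 /S -!andbA.
rewrite slanted_n std_n.
suff : n 0%N = (7 * n' 0)%N by lia.
have -> : (7 * n' 0 = n' 0 + n' 1 + n' 2 + n' 3 + n' 4 + n' 5 + n' 6)%N.
  by rewrite (n'0 1%N) (n'0 2%N) (n'0 3%N) (n'0 4%N) (n'0 5%N) (n'0 6%N); lia.
rewrite /n /n' /R /S !num7E -!big_split /=; apply: eq_bigr => x _.
rewrite -/(iter 2 shift7 x) -/(iter 3 shift7 x) -/(iter 4 shift7 x) -/(iter 5 shift7 x).
rewrite -/(iter 6 shift7 x) !P_shifts P_shift; case: (P x); rewrite ?andbF // !andbT.
case sx: (slanted x) => //=; case: x sx => [[[[[[x0 x1] x2] x3] x4] x5] x6].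
case/andP=> /affine7P[u [k2 [k3 [k4 [k5 [k6 [e1 [e2 [e3 [e4 [e5 e6]]]]]]]]]]] _.
rewrite /head7 /slope7 /= (@mulmod7 1 u 0 (x1 - x0)); last by lia.
have [u1|] := eqVneq ((1 * (u mod 7)) mod 7) 1 => //=.
rewrite (@shiftmod7 0 u x0 0 x0) ?(@shiftmod7 1 u x0 0 x1); [|lia..].
rewrite (@shiftmod7 2 u x0 k2 x2) ?(@shiftmod7 3 u x0 k3 x3); [|lia..].
rewrite (@shiftmod7 4 u x0 k4 x4) ?(@shiftmod7 5 u x0 k5 x5); [|lia..].
rewrite (@shiftmod7 6 u x0 k6 x6); last by lia.
apply/eqP; move/eqP: u1; apply/implyP.
by apply: (@all_res7 (fun r c _ => hit7 0 1 r 1 ==> (nat_of_bool true == (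
    hit7 c 0 r 4 + hit7 c 1 r 4 + hit7 c 2 r 4 + hit7 c 3 r 4 + hit7 c 4 r 4
    + hit7 c 5 r 4 + hit7 c 6 r 4)%N)) _ u x0 0); vm_compute.
Qed.

(** Here [v i] is the excess of runner [i] over the [K] beads it carries for the empty partition;
    the shifts i - 3 complete the square in the size of the core. *)
Definition bead_vec (K : nat) (c : nat -> nat) : vec7 :=
  let v i := Z.of_nat (c i) - Z.of_nat K in
  (7 * v 0%N - 3, 7 * v 1%N - 2, 7 * v 2%N - 1, 7 * v 3%N,
   7 * v 4%N + 1, 7 * v 5%N + 2, 7 * v 6%N + 3).

(* Runner lengths of the empty partition: even, so that BG-rank signs are those of
   the beads, and large enough for all
   solution vectors to have nonnegative runner lengths. *)
Definition beads_per_runner (n : nat) : nat := (2 * n + 2)%N.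
Notation nbeads n := (7 * beads_per_runner n)%N.

Definition core_vec (n : nat) (s : seq nat) : vec7 :=
  bead_vec (beads_per_runner n) (runner_count 7 (beta (nbeads n) s)).

Lemma std7_bead_vec K c : std7 (bead_vec K c).
Proof.
apply/std7P; exists (Z.of_nat (c 0%N) - Z.of_nat K), (Z.of_nat (c 1%N) - Z.of_nat K),
  (Z.of_nat (c 2%N) - Z.of_nat K), (Z.of_nat (c 3%N) - Z.of_nat K),
  (Z.of_nat (c 4%N) - Z.of_nat K), (Z.of_nat (c 5%N) - Z.of_nat K),
  (Z.of_nat (c 6%N) - Z.of_nat K).
by [].
Qed.

(** The bead positions add up to n plus those of the empty partition. The latter has norm 9 + 4 + 1
    + 0 + 1 + 4 + 9 = 28, whence n + 2. *)
Lemma bead_norm z0 z1 z2 z3 z4 z5 z6 S0 S1 S2 S3 S4 S5 S6 k n :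
    2 * S0 + 7 * z0 = 2 * (0 * z0) + 7 * (z0 * z0) ->
    2 * S1 + 7 * z1 = 2 * (1 * z1) + 7 * (z1 * z1) ->
    2 * S2 + 7 * z2 = 2 * (2 * z2) + 7 * (z2 * z2) ->
    2 * S3 + 7 * z3 = 2 * (3 * z3) + 7 * (z3 * z3) ->
    2 * S4 + 7 * z4 = 2 * (4 * z4) + 7 * (z4 * z4) ->
    2 * S5 + 7 * z5 = 2 * (5 * z5) + 7 * (z5 * z5) ->
    2 * S6 + 7 * z6 = 2 * (6 * z6) + 7 * (z6 * z6) ->
    2 * (S0 + S1 + S2 + S3 + S4 + S5 + S6) + 7 * k = 2 * n + 7 * k * (7 * k) ->
    z0 + z1 + z2 + z3 + z4 + z5 + z6 = 7 * k ->
  let x0 := 7 * (z0 - k) - 3 in let x1 := 7 * (z1 - k) - 2 in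
  let x2 := 7 * (z2 - k) - 1 in let x3 := 7 * (z3 - k) in
  let x4 := 7 * (z4 - k) + 1 in let x5 := 7 * (z5 - k) + 2 in
  let x6 := 7 * (z6 - k) + 3 in
  x0 + x1 + x2 + x3 + x4 + x5 + x6 = 0 /\
  x0 * x0 + x1 * x1 + x2 * x2 + x3 * x3 + x4 * x4 + x5 * x5 + x6 * x6 = 14 * (n + 2).
Proof.
(* The norm identity becomes linear in the monomials once the sum condition has been multiplied by
   [k]. *)
move=> h0 h1 h2 h3 h4 h5 h6 hS sum_z /=; have sum_zk := congr1 (fun a => a * k) sum_z.
cbv beta in sum_zk; split; first by clear -sum_z; lia.
by lia.
Qed.

Lemma beads7_sums K n c l s : perm_eq l (beads 7 c) -> l = beta (7 * K) s ->
    (size s <= 7 * K)%N ->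
  sphere7 (14 * (Z.of_nat n + 2)) (bead_vec K c) = (sumn s == n).
Proof.
move=> l_c def_l s_K.
have : (\sum_(i < 7) c i = 7 * K)%N.
  have := perm_size l_c; rewrite def_l size_beta => ->.
  rewrite -sum1_size (big_beads _ 7 c (fun=> 1%N)).
  by apply: eq_bigr => i _; rewrite sum1_card card_ord.
have := sum_beta s_K; rewrite -def_l (perm_big _ l_c) /= (big_beads _ 7 c id) /=.
rewrite !big_ord_recr !big_ord0 /=.
have := (sum_runner 0 7 (c 0%N), sum_runner 1 7 (c 1%N), sum_runner 2 7 (c 2%N),
  sum_runner 3 7 (c 3%N), sum_runner 4 7 (c 4%N), sum_runner 5 7 (c 5%N),
  sum_runner 6 7 (c 6%N)).
move: (\sum_(j < c 0%N) _)%N (\sum_(j < c 1%N) _)%N (\sum_(j < c 2%N) _)%N => S0 S1 S2.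
move: (\sum_(j < c 3%N) _)%N (\sum_(j < c 4%N) _)%N (\sum_(j < c 5%N) _)%N => S3 S4 S5.
move: (\sum_(j < c 6%N) _)%N => S6.
move=> [[[[[[h0 h1] h2] h3] h4] h5] h6].
move=> hS hC.
have [|||||||||-> ->] := @bead_norm (Z.of_nat (c 0%N)) (Z.of_nat (c 1%N))
  (Z.of_nat (c 2%N)) (Z.of_nat (c 3%N)) (Z.of_nat (c 4%N)) (Z.of_nat (c 5%N))
  (Z.of_nat (c 6%N)) (Z.of_nat S0) (Z.of_nat S1) (Z.of_nat S2) (Z.of_nat S3)
  (Z.of_nat S4) (Z.of_nat S5) (Z.of_nat S6) (Z.of_nat K) (Z.of_nat (sumn s)).
- by clear -h0; lia.
- by clear -h1; lia.
- by clear -h2; lia.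
- by clear -h3; lia.
- by clear -h4; lia.
- by clear -h5; lia.
- by clear -h6; lia.
- by clear -hS; lia.
- by clear -hC; lia.
by rewrite eqxx /=; apply/eqP/eqP; clear; lia.
Qed.

Lemma core_vec_sphere n s : is_partition n s -> is_core 7 s ->
  sphere7 (14 * (Z.of_nat n + 2)) (core_vec n s).
Proof.
case/and3P=> sorted_s pos_s /eqP sum_s core_s.
have s_N : (size s <= nbeads n)%N.
  have : (size s <= n)%N.
    rewrite -sum_s; elim: s pos_s {sum_s sorted_s core_s} => //= x s IHs.
    by case/andP=> x_gt0 /IHs; lia.
  by rewrite /beads_per_runner; lia.
rewrite (beads7_sums _ _ erefl s_N) ?sum_s //.
by apply: runner_countE; rewrite ?uniq_beta // -is_core_beta.
Qed.

Lemma core_vec_inj n s1 s2 : is_partition n s1 -> is_partition n s2 ->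
  is_core 7 s1 -> is_core 7 s2 -> core_vec n s1 = core_vec n s2 -> s1 = s2.
Proof.
have size_N s : is_partition n s -> (size s <= nbeads n)%N.
  case/and3P=> _ pos_s /eqP <-; rewrite /beads_per_runner.
  suff : (size s <= sumn s)%N by lia.
  by elim: s pos_s => //= x s IHs /andP[x_gt0 /IHs]; lia.
move=> part1 part2; have [s1_N s2_N] := (size_N _ part1, size_N _ part2).
have /and3P[sorted1 pos1 _] := part1; have /and3P[sorted2 pos2 _] := part2.
rewrite !(@is_core_beta 7 (nbeads n)) // => core1 core2 eq_vec.
apply: (beta_inj sorted1 sorted2 pos1 pos2 s1_N s2_N).
have gtn_trans : transitive gtn by move=> a b c /= ab bc; apply: ltn_trans bc ab.
apply: (irr_sorted_eq gtn_trans ltnn); rewrite ?sorted_beta // => b.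
rewrite !(@mem_runner 7) ?uniq_beta //.
have : (b %% 7 < 7)%N by rewrite ltn_mod.
move: (b %% 7)%N => i; case: eq_vec.
set c1 := runner_count 7 (beta _ s1); set c2 := runner_count 7 (beta _ s2).
move: c1 c2 (beads_per_runner n); clear => c1 c2 K h0 h1 h2 h3 h4 h5 h6.
by do 7?[case: i => [|i] //]; move=> _; congr (_ < _)%N; lia.
Qed.

Lemma core_vec_surj n x : sphere7 (14 * (Z.of_nat n + 2)) x -> std7 x ->
  exists s, [/\ is_partition n s, is_core 7 s & x = core_vec n s].
Proof.
move: x => [[[[[[x0 x1] x2] x3] x4] x5] x6] sph_x.
case/std7P=> v0 [v1 [v2 [v3 [v4 [v5 [v6 [e0 e1 e2 [e3 e4 e5 e6]]]]]]]].
pose K := beads_per_runner n; pose N := nbeads n.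
pose c i := nth 0%N [seq Z.to_nat (v + Z.of_nat K) | v <- [:: v0; v1; v2; v3; v4; v5; v6]] i.
have x_vec : (x0, x1, x2, x3, x4, x5, x6) = bead_vec K c.
  (* If v <= - (2 n + 3), then 7 v + d <= - (14 n + 18), whose square is too large; so [Z.to_nat]
     loses nothing. *)
  have bound v d : (7 * v + d) * (7 * v + d) <= 14 * (Z.of_nat n + 2) -> d <= 3 ->
      v = Z.of_nat (Z.to_nat (v + Z.of_nat K)) - Z.of_nat K.
    move=> h d3; suff K_v : 0 <= v + Z.of_nat K by rewrite Z2Nat.id //; lia.
    have -> : Z.of_nat K = 2 * Z.of_nat n + 2 by rewrite /K /beads_per_runner; lia.
    by nia.
  have [_ /eqP norm_x] := andP sph_x.
  have := (Z.square_nonneg x0, Z.square_nonneg x1, Z.square_nonneg x2,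
    Z.square_nonneg x3, Z.square_nonneg x4, Z.square_nonneg x5, Z.square_nonneg x6).
  move=> [[[[[[p0 p1] p2] p3] p4] p5] p6].
  have {p0 p1 p2 p3 p4 p5 p6} [b0 b1 b2 [b3 b4 b5 b6]] :
      let q := 14 * (Z.of_nat n + 2) in
      [/\ x0 * x0 <= q, x1 * x1 <= q, x2 * x2 <= q
        & [/\ x3 * x3 <= q, x4 * x4 <= q, x5 * x5 <= q & x6 * x6 <= q]].
    by move: norm_x p0 p1 p2 p3 p4 p5 p6; clear; do 3?split; lia.
  rewrite /bead_vec /c /= e0 e1 e2 e3 e4 e5 e6.
  rewrite -(bound v0 (- 3)) -1?(bound v1 (- 2)) -1?(bound v2 (- 1)) //;
    rewrite -1?(bound v3 0) -1?(bound v4 1) -1?(bound v5 2) -1?(bound v6 3) //.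
  - by move: b6; rewrite e6; clear; lia.
  - by move: b5; rewrite e5; clear; lia.
  - by move: b4; rewrite e4; clear; lia.
  - by move: b3; rewrite e3; clear; lia.
  - by move: b2; rewrite e2; clear; lia.
  - by move: b1; rewrite e1; clear; lia.
  by move: b0; rewrite e0; clear; lia.
have sum_c : (\sum_(i < 7) c i = N)%N.
  have := sph_x; rewrite x_vec /bead_vec => /andP[/eqP + _].
  rewrite !big_ord_recr big_ord0 /= -/(c 0%N) /N -/K; move: (c) (K); clear.
  by move=> c K; lia.
pose l := sort geq (beads 7 c).
have geq_total : total geq by move=> a b; exact: leq_total.
have l_c : perm_eq l (beads 7 c) by rewrite perm_sort.
have size_l : size l = N.
  rewrite (perm_size l_c) -sum1_size (big_beads _ 7 c (fun=> 1%N)) -sum_c.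
  by apply: eq_bigr => i _; rewrite sum1_card card_ord.
have uniq_l : uniq l by rewrite sort_uniq beads_uniq.
have sorted_l : sorted gtn l.
  by rewrite gtn_sorted_uniq_geq uniq_l sort_sorted.
pose s := unbeta N l; have beta_s : beta N s = l by apply: unbetaK.
have sorted_s : sorted geq s.
  apply: sorted_filter; last exact: sorted_gaps.
  by move=> a b d /= ab bd; apply: leq_trans bd ab.
have s_N : (size s <= N)%N.
  by rewrite size_filter (leq_trans (count_size _ _)) ?size_mkseq.
have sum_s : sumn s == n.
  by rewrite -(beads7_sums (K := K) n l_c (esym beta_s) s_N) -x_vec.
exists s; split.
- by apply/and3P; split=> //; exact: filter_all.
- by rewrite (is_core_beta (N := N)) // beta_s; apply: (@beads_closed 7 _ c) => // b;
    exact: perm_mem.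
rewrite x_vec /core_vec beta_s /bead_vec.
by rewrite !(@runner_count_beads 7 isT c).
Qed.

Lemma nb_partitions_count n (P : pred (seq nat)) :
  exists2 l, uniq l & (forall s, is_partition n s -> s \in l)
    /\ nb_partitions n P = count (fun s => is_partition n s && P s) l.
Proof.
pose l := undup [seq map val (bseqval b) | b : n.-bseq 'I_n.+1 <- enum {: n.-bseq 'I_n.+1}].
have l_part s : is_partition n s -> s \in l.
  move=> /partition_bseq[b <-]; rewrite mem_undup.
  by apply/mapP; exists b; rewrite ?mem_enum.
exists l; [exact: undup_uniq | split=> //].
rewrite -size_filter; apply: nb_partitionsE; first by rewrite filter_uniq ?undup_uniq.
move=> s; rewrite mem_filter; case: (boolP (is_partition n s)) => //= /l_part ->.
by rewrite andbT.
Qed.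

Lemma nb_cores n (f : pred (seq nat)) (P : pred vec7) :
    (forall s, is_partition n s -> is_core 7 s -> f s = P (core_vec n s)) ->
  nb_partitions n (fun s => is_core 7 s && f s)
    = num7 (14 * (Z.of_nat n + 2)) (fun x => std7 x && P x).
Proof.
move=> fP; have [l uniq_l [l_part ->]] := nb_partitions_count n (fun s => is_core 7 s && f s).
rewrite /num7; apply: (eq_count_rel (r := fun s x =>
  [/\ is_partition n s, is_core 7 s & x = core_vec n s])); rewrite ?box7_uniq //.
- by move=> s /andP[/l_part].
- by move=> x /andP[/mem_box7].
- move=> s /and3P[part_s core_s fs]; exists (core_vec n s) => //.
  by rewrite core_vec_sphere // std7_bead_vec -fP.
- move=> x /and3P[sph_x std_x Px].
  have [s [part_s core_s def_x]] := core_vec_surj sph_x std_x.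
  by exists s => //; rewrite part_s core_s fP // -def_x.
- by move=> s x x' [_ _ ->] [_ _ ->].
move=> s1 s2 x [part1 core1 ->] [part2 core2].
exact: core_vec_inj.
Qed.

(* The BG-rank on the abacus *)
Local Close Scope Z_scope.

(** As 7 is odd, signs alternate along a runner. *)
Lemma sum_sign_runner (i c : nat) :
  (\sum_(j < c) (-1) ^+ (i + 7 * j) = (-1) ^+ i * (odd c)%:Z :> int)%R.
Proof.
elim: c => [|c IHc]; first by rewrite big_ord0 mulr0.
rewrite big_ord_recr /= IHc exprD -signr_odd -(signr_odd _ (7 * c)) oddM /=.
by case: (odd i) (odd c) => [] [].
Qed.

Lemma sum_sign_even k : (\sum_(i < 2 * k) (-1) ^+ i = 0 :> int)%R.
Proof.
elim: k => [|k IHk]; first by rewrite big_ord0.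
rewrite (_ : 2 * k.+1 = (2 * k).+2); last by lia.
by rewrite 2!big_ord_recr /= IHk -signr_odd -(signr_odd _ (2 * k).+1) /= oddM.
Qed.

(** For even N the sign of the i-th bead is - (-1)^i (-1)^(s_i). Adding (-1)^i, which sums to 0,
    leaves 2 (-1)^i when s_i is odd and 0 otherwise. *)
Lemma BG_rank_beta N s : ~~ odd N -> size s <= N ->
  (BG_rank s *+ 2 = \sum_(b <- beta N s) (-1) ^+ b)%R.
Proof.
move=> even_N s_N; rewrite big_map big_iota.
have -> : BG_rank s = (\sum_(i < N) (-1) ^+ i * (odd (nth 0%N s i))%:Z)%R.
  rewrite /BG_rank -!(big_mkord xpredT (fun i => (-1) ^+ i * (odd (nth 0%N s i))%:Z)%R).
  rewrite [RHS](big_cat_nat (n := size s)) //= [X in (_ = _ + X)%R]big_nat.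
  by rewrite [X in (_ = _ + X)%R]big1 ?addr0 // => i /andP[s_i _]; rewrite nth_default ?mulr0.
have N2 : N = 2 * N./2 by rewrite mul2n -[LHS]odd_double_half (negbTE even_N).
have sum0 : (\sum_(i < N) (-1) ^+ i = 0 :> int)%R by rewrite N2 sum_sign_even.
rewrite -sumrMnl -[RHS]add0r; transitivity (\sum_(i < N) (-1) ^+ i
  + \sum_(i < N) (-1) ^+ (nth 0%N s i + (N - i.+1)) : int)%R; last by rewrite sum0.
rewrite -big_split /=.
apply: eq_bigr => i _; have i_N := ltn_ord i.
rewrite -signr_odd -(signr_odd _ (nth _ _ _ + _)) oddD oddB // (negbTE even_N) /=.
by case: (odd i) (odd (nth _ _ _)) => [] [].
Qed.

Lemma Zodd_of_nat k : Z.odd (Z.of_nat k) = odd k.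
Proof. by elim: k => // k IHk; rewrite Nat2Z.inj_succ Z.odd_succ -Z.negb_odd IHk. Qed.

(** An entry x_i is odd when the length of runner i is even for even i, odd for odd i. Four runners
    have even index, so the number of odd entries is 4 minus the signed count of runners of odd
    length. *)
Lemma BG_rank_core n s : is_partition n s -> is_core 7 s ->
  (BG_rank s *+ 2 = 4 - (nodd7 (core_vec n s))%:Z)%R.
Proof.
move=> part_s; have /and3P[sorted_s pos_s /eqP sum_s] := part_s.
have s_N : size s <= nbeads n.
  have : size s <= n.
    rewrite -sum_s; elim: s pos_s {sum_s sorted_s part_s} => //= x s IHs.
    by case/andP=> x_gt0 /IHs; lia.
  by rewrite /beads_per_runner; lia.
rewrite (is_core_beta (N := nbeads n)) // => closed_s.
rewrite (@BG_rank_beta (nbeads n)) //; last by rewrite oddM /beads_per_runner oddD oddM.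
rewrite (perm_big _ (runner_countE _ (uniq_beta _ sorted_s) closed_s)) //=.
rewrite big_beads /core_vec.
set c := runner_count 7 _; under eq_bigr => i _ do rewrite sum_sign_runner.
rewrite !big_ord_recr big_ord0 /= /bead_vec.
rewrite !Z.odd_sub !Z.odd_add !Z.odd_mul !Z.odd_sub !Zodd_of_nat.
have -> : odd (beads_per_runner n) = false by rewrite /beads_per_runner oddD oddM.
by case: (odd (c 0)) (odd (c 1)) (odd (c 2)) (odd (c 3)) (odd (c 4)) (odd (c 5))
  (odd (c 6)) => [] [] [] [] [] [] [].
Qed.

Lemma a7E n : a7 n = num7 (14 * (Z.of_nat n + 2)) std7.
Proof.
rewrite /a7; have := @nb_cores n (fun=> true) (fun=> true) (fun _ _ _ => erefl).
rewrite /nb_partitions => eq_num; transitivity (num7 (14 * (Z.of_nat n + 2)) (fun x => std7 x && true)).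
  rewrite -eq_num; apply: eq_card => s; rewrite !inE andbT //.
by apply: eq_in_num7 => x _; rewrite andbT.
Qed.

Lemma a7_BGE (j : int) k n : (j *+ 2 = 4 - k%:Z)%R ->
  a7_BG j n = num7 (14 * (Z.of_nat n + 2)) (fun x => std7 x && (nodd7 x == k)).
Proof.
move=> jk; apply: (@nb_cores n (fun s => BG_rank s == j)) => s part_s core_s.
have := BG_rank_core part_s core_s; move: (BG_rank s) (nodd7 _) => b d bd.
by apply/eqP/eqP; lia.
Qed.

(** * Growth of the counts *)

Section HeckeGrowth.

Local Open Scope Z_scope.

Variables E C : nat -> Z.
Hypothesis E1 : E 1%N = 5 * E 0%N.
Hypothesis C1 : C 1%N = - 3 * C 0%N.
Hypothesis ES : forall j, E j.+2 = 5 * E j.+1 - 4 * E j.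
Hypothesis CS : forall j, C j.+2 = - 3 * C j.+1 - 4 * C j.
Hypothesis CE0 : C 0%N <= E 0%N.
Hypothesis EC0 : 0 <= 3 * E 0%N + 5 * C 0%N.

Lemma hecke_growth j :
  2 * (E j - C j) <= E j.+1 - C j.+1 /\ 10 * (E j - C j) <= E j.+2 - C j.+2.
Proof.
(* The characteristic roots are 1 and 4 for E, and of modulus 2 for C, so C is negligible from index
   3 on; the first three cases are direct. *)
have bound i : [/\ 4 * E i.+3 <= E i.+4, 0 <= E i.+3, - E i.+3 <= 20 * C i.+3 <= E i.+3
    & - E i.+4 <= 20 * C i.+4 <= E i.+4].
  elim: i => [|i [h1 h2 h3 h4]]; first by rewrite !(ES, CS) E1 C1; split; lia.
  by have := (ES i.+3, CS i.+3); case=> -> ->; split; lia.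
case: j => [|[|[|j]]].
- by rewrite !(ES, CS) E1 C1; lia.
- by rewrite !(ES, CS) E1 C1; lia.
- by rewrite !(ES, CS) E1 C1; lia.
have [h1 h2 h3 h4] := bound j; have [h5 h6 h7 h8] := bound j.+1.
by lia.
Qed.

End HeckeGrowth.

Section Counts.

Local Open Scope Z_scope.

(** This and [countO] are A(k) and B(k); in the coordinates of [latM] the vectors counted by A(k)
    have [hnorm] 2 k. *)
Definition countM (k : nat) : nat := num7 (14 * Z.of_nat k) slanted.
Definition countO (k : nat) : nat := num6 (Z.of_nat k) (fun y => ~~ ell y).

Lemma even7_half k :
  num7 (14 * (2 * Z.of_nat k)) (fun x => slanted x && even7 x)
    = if odd k then 0%N else countM k./2.
Proof.
case: ifP => k_odd.
  rewrite (_ : 14 * (2 * _) = 4 * (7 * Z.of_nat k)); last by ring.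
  by rewrite num7_even7 num7_odd // Z.odd_mul Zodd_of_nat k_odd.
rewrite (_ : 14 * (2 * _) = 4 * (14 * Z.of_nat k./2)) ?num7_even7 //.
by have := odd_double_half k; rewrite k_odd; lia.
Qed.

Lemma twoO_half k :
  num6 (2 * Z.of_nat k) (fun y => ~~ ell y && twoO y)
    = if odd k then 0%N else countO k./2.
Proof.
have := odd_double_half k; case: ifP => _ def_k.
  by apply: num6_twoO_odd; rewrite -def_k; lia.
rewrite (_ : 2 * _ = 4 * Z.of_nat k./2); last by lia.
apply: num6_twoO => a1 b1 a2 b2 a3 b3; congr (~~ _).
by apply: (@eq0_mod7_scale 2 0) => //; ring.
Qed.

Lemma countM_double k :
  (countM (2 * k) + 2 * countM k + 4 * (if odd k then 0 else countM k./2)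
    = 7 * countO k)%N
  /\ (4 * countM k + 3 * (if odd k then 0 else countM k./2) <= 7 * countO k)%N.
Proof.
have := hecke_M (Z.of_nat k); rewrite even7_half -/(countM k) -/(countO k).
by rewrite /countM (_ : Z.of_nat (2 * k) = 2 * Z.of_nat k) //; lia.
Qed.

Lemma countO_double k :
  (countO (2 * k) + 2 * countO k + 4 * (if odd k then 0 else countO k./2)
    = 6 * countO k + countM k)%N.
Proof.
have := hecke_O (Z.of_nat k); rewrite twoO_half -/(countO k).
rewrite /countO (_ : Z.of_nat (2 * k) = 2 * Z.of_nat k); last by lia.
move->; congr addn; symmetry; rewrite /countM.
under eq_in_num7 => x _ do rewrite -[slanted x]andbT.
rewrite (num7_ofM_slanted _ (fun=> true)).
by apply: eq_in_num6 => y _; rewrite andbT.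
Qed.

Lemma countO_nonresidue k : (k %% 7)%N \in [:: 3; 5; 6]%N -> countO k = countM k.
Proof.
move=> k_nres; symmetry; apply: num7_slanted_nonresidue.
move: k_nres; rewrite !inE; have := divn_eq k 7; lia.
Qed.

Lemma two_adic k : (0 < k)%N -> exists j k0, odd k0 /\ k = (2 ^ j * k0)%N.
Proof.
elim/ltn_ind: k => k IHk k_gt0; case k_odd: (odd k).
  by exists 0%N, k; rewrite mul1n.
have def_k : k = (2 * k./2)%N by have := odd_double_half k; rewrite k_odd; lia.
have [||j [k0 [k0_odd def_k2]]] := IHk k./2; [lia | lia |].
by exists j.+1, k0; split=> //; rewrite def_k {1}def_k2 expnS mulnA.
Qed.

Lemma countM_growth k : (0 < k)%N ->
  (2 * countM k <= countM (2 * k))%N /\ (10 * countM k <= countM (4 * k))%N.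
Proof.
case/two_adic=> j [k0 [k0_odd ->]].
pose A i := Z.of_nat (countM (2 ^ i * k0)); pose B i := Z.of_nat (countO (2 ^ i * k0)).
have step i : (2 ^ i.+1 * k0 = 2 * (2 ^ i * k0))%N by rewrite expnS mulnA.
have even_pow i : odd (2 ^ i.+1 * k0) = false by rewrite step oddM.
have half_pow i : (2 ^ i.+1 * k0)./2 = (2 ^ i * k0)%N by rewrite step mul2n doubleK.
have A1 : A 1%N = 7 * B 0%N - 2 * A 0%N.
  have [+ _] := countM_double (2 ^ 0 * k0).
  by rewrite -step /A /B mul1n k0_odd; lia.
have B1 : B 1%N = 4 * B 0%N + A 0%N.
  have := countO_double (2 ^ 0 * k0).
  by rewrite -step /A /B mul1n k0_odd; lia.
have AS i : A i.+2 = 7 * B i.+1 - 2 * A i.+1 - 4 * A i.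
  have [+ _] := countM_double (2 ^ i.+1 * k0).
  by rewrite -step /A /B even_pow half_pow; lia.
have BS i : B i.+2 = 4 * B i.+1 + A i.+1 - 4 * B i.
  have := countO_double (2 ^ i.+1 * k0).
  by rewrite -step /A /B even_pow half_pow; lia.
have A0B0 : 4 * A 0%N <= 7 * B 0%N.
  have [_] := countM_double (2 ^ 0 * k0).
  by rewrite /A /B mul1n k0_odd; lia.
have : 2 * A j <= A j.+1 /\ 10 * A j <= A j.+2.
  (* The eigenvectors for 5 and - 3, scaled so that their difference is 8 A. The initial conditions
     become A >= 0 and 7 B >= 4 A. *)
  have := @hecke_growth (fun i => A i + 7 * B i) (fun i => 7 * B i - 7 * A i)
    _ _ _ _ _ _ j.
  case=> [||i|i|||]; rewrite ?A1 ?B1 ?AS ?BS; try lia.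
  by rewrite /A; lia.
rewrite (_ : (4 * _)%N = (2 ^ j.+2 * k0)%N) -?step; last by rewrite 2!step; lia.
rewrite /A; move: (countM (2 ^ j * k0)) (countM (2 ^ j.+1 * k0)) (countM (2 ^ j.+2 * k0)).
by clear; lia.
Qed.

Lemma nodd7_shift7 x : nodd7 (shift7 x) = nodd7 x.
Proof. by case: x => [[[[[[x0 x1] x2] x3] x4] x5] x6] /=; lia. Qed.

Lemma nodd7_mul7 x : nodd7 (mul7 x) = nodd7 x.
Proof. by case: x => [[[[[[x0 x1] x2] x3] x4] x5] x6] /=; lia. Qed.

Lemma a7_countM n : (42 * a7 n)%N = countM (n + 2).
Proof.
have := @num7_std (14 * Z.of_nat (n + 2)) (fun=> true) (fun=> erefl) (fun=> erefl).
rewrite a7E /countM (_ : Z.of_nat (n + 2) = Z.of_nat n + 2); last by lia.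
by under eq_in_num7 => x _ do rewrite andbT; move->; congr muln;
  apply: eq_in_num7 => x _; rewrite andbT.
Qed.

Lemma a7_BG_slanted j k n : (j *+ 2 = 4 - k%:Z)%R ->
  (42 * a7_BG j n)%N = num7 (14 * Z.of_nat (n + 2)) (fun x => slanted x && (nodd7 x == k)).
Proof.
move=> jk; rewrite num7_std => [|x|x]; rewrite ?nodd7_shift7 ?nodd7_mul7 //.
by rewrite (a7_BGE _ jk) (_ : Z.of_nat (n + 2) = Z.of_nat n + 2) //; lia.
Qed.

Lemma nodd7_0 x : (nodd7 x == 0%N) = even7 x.
Proof.
case: x => [[[[[[x0 x1] x2] x3] x4] x5] x6] /=.
by case: (Z.odd x0) (Z.odd x1) (Z.odd x2) (Z.odd x3) (Z.odd x4) (Z.odd x5)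
         (Z.odd x6) => [] [] [] [] [] [] [].
Qed.

(** BG-rank 2 means all entries even, so these cores exist only if n + 2 = 4 h, and then number A(h)
    / 42. For such n the remaining vectors have four odd entries, and 10 A(h) <= A(4 h) leaves at
    least 9 A(h) of them. *)
Lemma a7_BG_0_2 n : (9 * a7_BG 2%R n <= a7_BG 0%R n)%N.
Proof.
have BG0 := @a7_BG_slanted 0%R 4 n erefl; have BG2 := @a7_BG_slanted 2%R 0 n erefl.
have {}BG2 : (42 * a7_BG 2%R n)%N
    = num7 (14 * Z.of_nat (n + 2)) (fun x => slanted x && even7 x).
  by rewrite BG2; apply: eq_in_num7 => x _; rewrite nodd7_0.
have [m_odd | m_even] := boolP (odd (n + 2)).
  suff -> : a7_BG 2%R n = 0%N by [].
  suff : num7 (14 * Z.of_nat (n + 2)) (fun x => slanted x && even7 x) = 0%N by lia.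
  apply/eqP; rewrite -leqn0 leqNgt -has_count; apply/hasPn => x _ /=.
  apply/negP => /and3P[/sphere7_nodd7[k + _]]; rewrite -nodd7_0 => + /eqP x0.
  by rewrite x0; have := odd_double_half (n + 2); rewrite m_odd; lia.
have def_m : (n + 2 = 2 * (n + 2)./2)%N.
  by rewrite mul2n -[LHS]odd_double_half (negbTE m_even).
move: BG2; rewrite {1}def_m (_ : Z.of_nat (2 * _) = 2 * Z.of_nat (n + 2)./2); last by lia.
rewrite even7_half; case: ifP => [_ BG2|half_even BG2]; first by lia.
set h := (n + 2)./2./2 in BG2.
have def_h : (n + 2 = 4 * h)%N.
  by have := odd_double_half (n + 2)./2; rewrite half_even /h; lia.
have [_ growth] : (2 * countM h <= countM (2 * h))%N /\ (10 * countM h <= countM (4 * h))%N.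
  by apply: countM_growth; lia.
have split_m : (countM (n + 2) = 42 * a7_BG 0%R n + 42 * a7_BG 2%R n)%N.
  rewrite BG0 (@a7_BG_slanted 2%R 0 n erefl) /countM !num7E -big_split /=.
  apply: eq_bigr => x /sphere7_nodd7[k hk]; case: (slanted x) => //=.
  have : (nodd7 x %% 4)%N = 0%N by lia.
  have : (nodd7 x <= 7)%N.
    case: (x) => [[[[[[x0 x1] x2] x3] x4] x5] x6] /=.
    by do 7!case: (Z.odd _).
  by case: (nodd7 x) => [|[|[|[|[|[|[|[|]]]]]]]].
by move: split_m; rewrite {1}def_h; lia.
Qed.

Lemma a7_BG_1_N1 n : (2 * a7_BG (-1)%R n <= a7_BG 1%R n)%N.
Proof.
have := num7_nodd2_ge (Z.of_nat (n + 2)).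
rewrite -(@a7_BG_slanted 1%R 2 n erefl) -(@a7_BG_slanted (-1)%R 6 n erefl).
by move: (a7_BG 1%R n) (a7_BG _ n) => b1 b2; lia.
Qed.

(** With A(k) = B(k) and no term at k / 2, the doubling relation reads A(2 k) = 5 A(k). *)
Lemma a7_odd_nonresidue n k : (n + 2 = 2 * k)%N -> odd k ->
  (k %% 7)%N \in [:: 3; 5; 6]%N -> (42 * a7 n = 5 * countM k)%N.
Proof.
move=> def_n k_odd /countO_nonresidue eq_k; rewrite a7_countM def_n.
by have [+ _] := countM_double k; rewrite k_odd eq_k; lia.
Qed.

End Counts.

Theorem theorem1p1 (n : nat) :
  a7 (2 * n + 2) >= 2 * a7 n /\
  a7 (4 * n + 6) >= 10 * a7 n /\
  a7_BG 0%Z n >= 9 * a7_BG 2%Z n /\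
  a7_BG 1%Z n >= 2 * a7_BG (-1)%Z n /\
  (forall r : nat, r \in [:: 1; 2; 6] ->
     a7 (28 * n + 4 * r) = 5 * a7 (14 * n + 2 * r - 1)) /\
  (forall r : nat, r \in [:: 2; 4; 5] ->
     a7 (28 * n + 4 * r + 2) + 4 * a7 (7 * n + r - 1)
       = 5 * a7 (14 * n + 2 * r)).
Proof.
have n2_gt0 : 0 < n + 2 by rewrite addn2.
have [growth2 growth4] := countM_growth n2_gt0.
do 5?split.
- have := a7_countM (2 * n + 2).
  by rewrite (_ : 2 * n + 2 + 2 = 2 * (n + 2)); have := a7_countM n; lia.
- have := a7_countM (4 * n + 6).
  by rewrite (_ : 4 * n + 6 + 2 = 4 * (n + 2)); have := a7_countM n; lia.
- exact: a7_BG_0_2.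
- exact: a7_BG_1_N1.
- move=> r r_val; have r_gt0 : 0 < r by move: r_val; rewrite !inE; lia.
  have := a7_countM (14 * n + 2 * r - 1); set k := _ + 2 => eq_k.
  have def_2k : 28 * n + 4 * r + 2 = 2 * k by rewrite /k; lia.
  (* Modulo 7, [k] is 2 r + 1. *)
  have k_nres : k %% 7 \in [:: 3; 5; 6] by move: r_val; rewrite /k !inE; lia.
  have k_odd : odd k by rewrite /k; lia.
  by have := a7_odd_nonresidue def_2k k_odd k_nres; rewrite -eq_k; lia.
move=> r r_val; have r_gt0 : 0 < r by move: r_val; rewrite !inE; lia.
have h0 := a7_countM (7 * n + r - 1); have h1 := a7_countM (14 * n + 2 * r).
have := a7_countM (28 * n + 4 * r + 2).
set h := 7 * n + r - 1 + 2 in h0.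
rewrite (_ : 28 * n + 4 * r + 2 + 2 = 2 * (2 * h)); last by rewrite /h; lia.
rewrite (_ : 14 * n + 2 * r + 2 = 2 * h) in h1; last by rewrite /h; lia.
have k_nres : (2 * h) %% 7 \in [:: 3; 5; 6] by move: r_val; rewrite /h !inE; lia.
(* Modulo 7, 2 h is 2 r + 2. With B(2 h) = A(2 h), doubling gives A(4 h) + 4 A(h) = 5 A(2 h). *)
have := countO_nonresidue k_nres; have [+ _] := countM_double (2 * h).
rewrite oddM /= (_ : (2 * h)./2 = h); last by rewrite mul2n doubleK.
by move: h0 h1; clear; lia.
Qed.
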